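(* Let $n,r\ge 2$ and $\ell\ge 0$ be integers with $0\le \ell<r$. The space $\boldsymbol W_{n,\ell}$ is a $\mathbb C$-vector space of dimension $d_{n,\ell}:=\binom{n+\ell-2}{\ell}$ and defines a representation of the braid group $B_n$ given by a homomorphism $\rho^{\boldsymbol W}_{n,\ell}:B_n\to \mathrm{GL}(d_{n,\ell},\mathbb C)$. Further, this representation is isomorphic to a specialization of the Lawrence representation $\boldsymbol W^{\mathrm{JK}}_{n,\ell}$, namely the one with variables specialized to $q=e^{\pi i/r}$ and $s=q^{r-1}$.
   Context: $B_n$ is the braid group on $n$ strands with Artin generators $\sigma_1,\dots,\sigma_{n-1}$. Let $r\ge 2$, $q=e^{\pi i/r}$, $s=q^{r-1}=-q^{-1}$, $\{x\}=q^x-q^{-x}$, $[x]=\{x\}/\{1\}$, $[m]!=[m]\cdots[1]$, $\begin{bmatrix} a\\ b\end{bmatrix}=\frac{[a]!}{[a-b]!\,[b]!}$. Root of unity case: let $V$ be the complex vector space with basis $u_0,\dots,u_{r-1}$ (put $u_{-1}=u_r=0$) and operators $E u_m=u_{m-1}$, $K u_m=s q^{-2m}u_m$. On $V^{\otimes n}$, $E$ acts as $\sum_{i=1}^n 1^{\otimes (i-1)}\otimes E\otimes K^{\otimes (n-i)}$. Let $$\mathsf R(u_i\otimes u_j)=s^{-(i+j)}\sum_{a=0}^{\min(i,r-j-1)} q^{2(i-a)(j+a)}q^{a(a-1)/2}\begin{bmatrix} a+j\\ j\end{bmatrix}\prod_{m=0}^{a-1}\{m+j+1\}\;u_{j+a}\otimes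 u_{i-a},$$ and let $B_n$ act on $V^{\otimes n}$ by $\sigma_i=1^{\otimes(i-1)}\otimes \mathsf R\otimes 1^{\otimes(n-i-1)}$ (this commutes with $E$). Put $\boldsymbol V_{n,\ell}=\mathrm{span}\{u_{\varepsilon_1}\otimes\cdots\otimes u_{\varepsilon_n}:0\le\varepsilon_i\le r-1,\ \sum\varepsilon_i=\ell\}$ and $\boldsymbol W_{n,\ell}=\ker(E)\cap\boldsymbol V_{n,\ell}$. Generic case (Jackson–Kerler): let $q,s$ be indeterminates and $\mathbb L=\mathbb Z[q^{\pm1},s^{\pm1}]$. Let $V^{\mathrm{gen}}$ be the free $\mathbb L$-module with basis $v_0,v_1,v_2,\dots$ ($v_{-1}=0$), $Ev_j=v_{j-1}$, $Kv_j=sq^{-2j}v_j$, and $$\mathsf R(v_i\otimes v_j)=s^{-(i+j)}\sum_{a=0}^{i}q^{2(i-a)(j+a)}q^{a(a-1)/2}\begin{bmatrix} a+j\\ j\end{bmatrix}\prod_{m=0}^{a-1}\big(sq^{-m-j}-s^{-1}q^{m+j}\big)\;v_{j+a}\otimes v_{i-a}.$$ With the same formulas for the action of $E$ on tensor powers and of $\sigma_i$, $\boldsymbol V^{\mathrm{JK}}_{n,\ell}$ is the $\mathbb L$-span of $v_{\varepsilon_1}\otimes\cdots\otimes v_{\varepsilon_n}$ with $\varepsilon_i\in\mathbb N$, $\sum\varepsilon_i=\ell$, and $\boldsymbol W^{\mathrm{JK}}_{n,\ell}=\ker(E)\cap \boldsymbol V^{\mathrm{JK}}_{n,\ell}$,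 a $B_n$-representation over $\mathbb L$. It is known (Jackson–Kerler, Ito, Kohno) to be isomorphic to the $\ell$-th Lawrence representation and is referred to as such. Its specialization at complex values of $q,s$ is its base change $\boldsymbol W^{\mathrm{JK}}_{n,\ell}\otimes_{\mathbb L}\mathbb C$ along the corresponding ring homomorphism $\mathbb L\to\mathbb C$. *)

(* Defs.v *)
From HB Require Import structures.
From mathcomp Require Import all_boot all_order all_algebra.
From mathcomp Require Import boolp reals trigo.
From mathcomp Require Import ring.
From mathcomp Require Import complex.
From mathcomp.multinomials Require Import freeg.
Set Implicit Arguments.
Unset Strict Implicit.
Unset Printing Implicit Defensive.
Import Order.TTheory GRing.Theory Num.Theory.
Local Open Scope ring_scope.
Local Open Scope quotient_scope.

Section BraidGroup.
Variable n : nat.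

(* A letter (i, false) is the Artin generator sigma_{i+1}, (i, true) is its
   inverse. *)
Definition braid_word := seq ('I_n.-1 * bool).

Inductive braid_eq : braid_word -> braid_word -> Prop :=
| BraidRefl u : braid_eq u u
| BraidSym u v : braid_eq u v -> braid_eq v u
| BraidTrans u v w : braid_eq u v -> braid_eq v w -> braid_eq u w
| BraidCat u u' v v' :
    braid_eq u u' -> braid_eq v v' -> braid_eq (u ++ v) (u' ++ v')
| BraidCancel i b : braid_eq [:: (i, b); (i, ~~ b)] [::]
| BraidFar (i j : 'I_n.-1) : (i.+1 < j)%N ->
    braid_eq [:: (i, false); (j, false)] [:: (j, false); (i, false)]
| BraidNear (i j : 'I_n.-1) : i.+1 = j ->
    braid_eq [:: (i, false); (j, false); (i, false)]
             [:: (j, false); (i, false); (j, false)].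

Definition braid_eqb (u v : braid_word) : bool := `[< braid_eq u v >].

Lemma braid_eqb_refl : reflexive braid_eqb.
Proof. by move=> u; apply/asboolP; apply: BraidRefl. Qed.

Lemma braid_eqb_sym : symmetric braid_eqb.
Proof. by move=> u v; apply/asboolP/asboolP; apply: BraidSym. Qed.

Lemma braid_eqb_trans : transitive braid_eqb.
Proof.
by move=> v u w /asboolP uv /asboolP vw; apply/asboolP; apply: BraidTrans uv vw.
Qed.

Canonical braid_equiv :=
  EquivRel braid_eqb braid_eqb_refl braid_eqb_sym braid_eqb_trans.

Definition braid := {eq_quot braid_eqb}.
HB.instance Definition _ := Choice.on braid.
HB.instance Definition _ : EqQuotient _ braid_eqb braid := EqQuotient.on braid.

Lemma braid_piP (u v : braid_word) :
  reflect (braid_eq u v) (\pi_braid u == \pi_braid v).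
Proof. by rewrite eqmodE; apply: asboolP. Qed.

Lemma braid_reprK (u : braid_word) : braid_eq (repr (\pi_braid u)) u.
Proof. by apply/braid_piP; rewrite reprK. Qed.

Definition word_inv (u : braid_word) : braid_word :=
  rev [seq (x.1, ~~ x.2) | x <- u].

Lemma word_inv_cat u v : word_inv (u ++ v) = word_inv v ++ word_inv u.
Proof. by rewrite /word_inv map_cat rev_cat. Qed.

Lemma word_invK : involutive word_inv.
Proof.
move=> u; rewrite /word_inv map_rev revK -map_comp -[RHS]map_id.
by apply: eq_map => -[i b] /=; rewrite negbK.
Qed.

Lemma word_mulV u : braid_eq (u ++ word_inv u) [::].
Proof.
elim: u => [|[i b] u IH]; first exact: BraidRefl.
rewrite -cat1s word_inv_cat -catA [u ++ _]catA.
apply: (BraidTrans (v := [:: (i, b)] ++ ([::] ++ word_inv [:: (i, b)]))).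
  by do 2?[apply: BraidCat; try exact: BraidRefl].
exact: BraidCancel.
Qed.

Lemma braid_eq_inv u v : braid_eq u v -> braid_eq (word_inv u) (word_inv v).
Proof.
move=> uv; have vV : braid_eq (v ++ word_inv v) [::] by exact: word_mulV.
have uV : braid_eq (word_inv u ++ u) [::].
  by rewrite -{2}[u]word_invK; apply: word_mulV.
apply: (BraidTrans (v := word_inv u ++ (v ++ word_inv v))).
  rewrite -{1}[word_inv u]cats0; apply: BraidCat; first exact: BraidRefl.
  exact: BraidSym.
rewrite catA -{2}[word_inv v]cat0s; apply: BraidCat; last exact: BraidRefl.
apply: BraidTrans uV; apply: BraidCat; first exact: BraidRefl.
exact: BraidSym.
Qed.

Definition braid_one : braid := \pi_braid [::].
Definition braid_mul (g h : braid) : braid := \pi_braid (repr g ++ repr h).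
Definition braid_inv (g : braid) : braid := \pi_braid (word_inv (repr g)).

Lemma braid_mulE u v : braid_mul (\pi_braid u) (\pi_braid v) = \pi_braid (u ++ v).
Proof.
apply/eqP; rewrite /braid_mul; apply/braid_piP.
by apply: BraidCat; apply: braid_reprK.
Qed.

Lemma braid_invE u : braid_inv (\pi_braid u) = \pi_braid (word_inv u).
Proof. by apply/eqP/braid_piP; apply: braid_eq_inv; apply: braid_reprK. Qed.

Lemma braid_mulA : associative braid_mul.
Proof.
elim/quotW=> u; elim/quotW=> v; elim/quotW=> w.
by rewrite (braid_mulE v w) (braid_mulE u v) !braid_mulE catA.
Qed.

Lemma braid_mul1 : left_id braid_one braid_mul.
Proof. by elim/quotW=> u; rewrite /braid_one braid_mulE. Qed.

Lemma braid_mulr1 : right_id braid_one braid_mul.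
Proof. by elim/quotW=> u; rewrite /braid_one braid_mulE cats0. Qed.

Lemma braid_mulV : left_inverse braid_one braid_inv braid_mul.
Proof.
elim/quotW=> u; rewrite braid_invE braid_mulE; apply/eqP/braid_piP.
by rewrite -{2}[u]word_invK; apply: word_mulV.
Qed.

Lemma braid_mulrV : right_inverse braid_one braid_inv braid_mul.
Proof.
elim/quotW=> u; rewrite braid_invE braid_mulE; apply/eqP/braid_piP.
exact: word_mulV.
Qed.

HB.instance Definition _ := isGroup.Build braid
  braid_mulA braid_mul1 braid_mulr1 braid_mulV braid_mulrV.

Definition artin (i : 'I_n.-1) : braid := \pi_braid [:: (i, false)].

End BraidGroup.

Section GL.
Variables (K : fieldType) (d : nat).

Record GL := MkGL { GLmx :> 'M[K]_d; GLmx_unit : GLmx \in unitmx }.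

HB.instance Definition _ := [isSub for GLmx].
HB.instance Definition _ := [Choice of GL by <:].

Definition GL1 : GL := MkGL (unitmx1 K d).
Definition GLV (A : GL) : GL.
Proof. by exists (invmx A); rewrite unitmx_inv GLmx_unit. Defined.
Definition GLM (A B : GL) : GL.
Proof. by exists (A *m B); rewrite unitmx_mul !GLmx_unit. Defined.

Lemma GL_mulA : associative GLM.
Proof. by move=> A B C; apply: val_inj; apply: mulmxA. Qed.
Lemma GL_mul1 : left_id GL1 GLM.
Proof. by move=> A; apply: val_inj; apply: mul1mx. Qed.
Lemma GL_mulr1 : right_id GL1 GLM.
Proof. by move=> A; apply: val_inj; apply: mulmx1. Qed.
Lemma GL_mulV : left_inverse GL1 GLV GLM.
Proof. by move=> A; apply: val_inj; apply/mulVmx/GLmx_unit. Qed.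
Lemma GL_mulrV : right_inverse GL1 GLV GLM.
Proof. by move=> A; apply: val_inj; apply/mulmxV/GLmx_unit. Qed.

HB.instance Definition _ :=
  isGroup.Build GL GL_mulA GL_mul1 GL_mulr1 GL_mulV GL_mulrV.

End GL.

Definition is_rep (G : groupType) (A : nzRingType) (M : lmodType A)
    (act : G -> {linear M -> M}) : Prop :=
  (act 1%g =1 id) /\ (forall g h, act (g * h)%g =1 act g \o act h).

Section Span.
Variables (A : nzRingType) (M : lmodType A) (P : M -> Prop).

Definition in_span (x : M) : Prop :=
  exists t : seq (A * M),
    (forall p, p \in t -> P p.2) /\ x = \sum_(p <- t) p.1 *: p.2.

Lemma in_span0 : in_span 0.
Proof. by exists [::]; split=> //; rewrite big_nil. Qed.

Lemma in_spanD x y : in_span x -> in_span y -> in_span (x + y).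
Proof.
move=> [t [Pt ->]] [u [Pu ->]]; exists (t ++ u); split; last by rewrite big_cat.
by move=> p; rewrite mem_cat => /orP[/Pt|/Pu].
Qed.

Lemma in_spanZ a x : in_span x -> in_span (a *: x).
Proof.
move=> [t [Pt ->]]; exists [seq (a * p.1, p.2) | p <- t]; split.
  by move=> p /mapP[p' /Pt Pp ->].
by rewrite big_map scaler_sumr; apply: eq_bigr => p _; rewrite scalerA.
Qed.

Lemma in_spanN x : in_span x -> in_span (- x).
Proof. by rewrite -scaleN1r; apply: in_spanZ. Qed.

Lemma in_span_gen x : P x -> in_span x.
Proof.
move=> Px; exists [:: (1, x)]; split; last by rewrite big_seq1 scale1r.
by move=> p; rewrite inE => /eqP ->.
Qed.

End Span.

Section Quotient.
Variables (A : nzRingType) (M : lmodType A) (P : M -> Prop).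

Definition span_eqb (x y : M) : bool := `[< in_span P (x - y) >].

Lemma span_eqb_refl : reflexive span_eqb.
Proof. by move=> x; apply/asboolP; rewrite subrr; apply: in_span0. Qed.

Lemma span_eqb_sym : symmetric span_eqb.
Proof.
by move=> x y; apply/asboolP/asboolP => /in_spanN; rewrite opprB.
Qed.

Lemma span_eqb_trans : transitive span_eqb.
Proof.
move=> y x z /asboolP xy /asboolP yz; apply/asboolP.
by rewrite -(subrKA y); apply: in_spanD.
Qed.

Canonical span_equiv :=
  EquivRel span_eqb span_eqb_refl span_eqb_sym span_eqb_trans.

(* M modulo the submodule spanned by P *)
Definition modquot := {eq_quot span_eqb}.
HB.instance Definition _ := Choice.on modquot.
HB.instance Definition _ : EqQuotient _ span_eqb modquot :=
  EqQuotient.on modquot.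

Lemma modquotP (x y : M) :
  (\pi_modquot x = \pi_modquot y) <-> in_span P (x - y).
Proof.
split=> [/eqP|h]; first by rewrite eqmodE => /asboolP.
by apply/eqP; rewrite eqmodE; apply/asboolP.
Qed.

Lemma modquot_repr (x : M) : in_span P (repr (\pi_modquot x) - x).
Proof. by apply/modquotP; rewrite reprK. Qed.

Definition modquot_zero : modquot := \pi_modquot 0.
Definition modquot_add (x y : modquot) : modquot := \pi_modquot (repr x + repr y).
Definition modquot_opp (x : modquot) : modquot := \pi_modquot (- repr x).
Definition modquot_scale (a : A) (x : modquot) : modquot :=
  \pi_modquot (a *: repr x).

Lemma modquot_addE x y :
  modquot_add (\pi_modquot x) (\pi_modquot y) = \pi_modquot (x + y).
Proof.
by apply/modquotP; rewrite opprD addrACA; apply: in_spanD; apply: modquot_repr.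
Qed.

Lemma modquot_oppE x : modquot_opp (\pi_modquot x) = \pi_modquot (- x).
Proof. by apply/modquotP; rewrite -opprD; apply/in_spanN/modquot_repr. Qed.

Lemma modquot_scaleE a x :
  modquot_scale a (\pi_modquot x) = \pi_modquot (a *: x).
Proof. by apply/modquotP; rewrite -scalerBr; apply/in_spanZ/modquot_repr. Qed.

Lemma modquot_addA : associative modquot_add.
Proof.
elim/quotW=> x; elim/quotW=> y; elim/quotW=> z.
by rewrite (modquot_addE y z) (modquot_addE x y) !modquot_addE addrA.
Qed.
Lemma modquot_addC : commutative modquot_add.
Proof. by move=> x y; rewrite /modquot_add addrC. Qed.
Lemma modquot_add0 : left_id modquot_zero modquot_add.
Proof. by elim/quotW=> x; rewrite modquot_addE add0r. Qed.
Lemma modquot_addN : left_inverse modquot_zero modquot_opp modquot_add.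
Proof. by elim/quotW=> x; rewrite modquot_oppE modquot_addE addNr. Qed.

HB.instance Definition _ := GRing.isZmodule.Build modquot
  modquot_addA modquot_addC modquot_add0 modquot_addN.

Lemma modquot_scaleA a b x :
  modquot_scale a (modquot_scale b x) = modquot_scale (a * b) x.
Proof.
by elim/quotW: x => x; rewrite (modquot_scaleE b) !modquot_scaleE scalerA.
Qed.
Lemma modquot_scale1 : left_id 1 modquot_scale.
Proof. by elim/quotW=> x; rewrite modquot_scaleE scale1r. Qed.
Lemma modquot_scaleDr : right_distributive modquot_scale +%R.
Proof.
move=> a; elim/quotW=> x; elim/quotW=> y.
rewrite [X in modquot_scale a X](modquot_addE x y) !modquot_scaleE scalerDr.
by rewrite -modquot_addE.
Qed.
Lemma modquot_scaleDl x : {morph modquot_scale^~ x : a b / a + b}.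
Proof.
elim/quotW: x => x a b; rewrite !modquot_scaleE scalerDl.
by rewrite -modquot_addE.
Qed.

HB.instance Definition _ := GRing.Zmodule_isLmodule.Build A modquot
  modquot_scaleA modquot_scale1 modquot_scaleDr modquot_scaleDl.

Lemma modquot_pi_linear : linear (\pi_modquot : M -> modquot).
Proof. by move=> a x y; rewrite -modquot_addE -modquot_scaleE. Qed.

End Quotient.

Section FreeLift.
Variables (A : comNzRingType) (J : choiceType) (M : lmodType A).

Lemma fglift_linear (f : J -> M) : linear (fglift f : {freeg J / A} -> M).
Proof.
set F : {freeg J / A} -> M := fglift f.
have FB : {morph F : x y / x - y} by exact: lift_is_additive.
have F0 : F 0 = 0 by rewrite -[0 in LHS](subrr 0) FB subrr.
have FN z : F (- z) = - F z by rewrite -sub0r FB F0 sub0r.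
have FD : {morph F : x y / x + y}.
  by move=> x y; rewrite -[y in LHS]opprK FB FN opprK.
move=> a x y; rewrite FD; congr (_ + _).
rewrite -[in RHS](freeg_sumE x) {1}/GRing.scale /= /fgscale.
rewrite !(big_morph F FD F0) scaler_sumr; apply: eq_bigr => z _.
by rewrite /F !liftU scalerA.
Qed.

Lemma freegZU (a b : A) (z : J) :
  a *: << b *g z >> = << a * b *g z >> :> {freeg J / A}.
Proof. by apply/eqP/freeg_eqP=> y; rewrite coeffZ !coeffU mulrA. Qed.

HB.instance Definition _ (f : J -> M) :=
  GRing.isLinear.Build A {freeg J / A} M *:%R (fglift f) (fglift_linear f).

End FreeLift.

Section BaseChange.
Variables (A : comNzRingType) (K : fieldType) (theta : {rmorphism A -> K}).

Section Object.
Variable M : lmodType A.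

(* K is an A-algebra through theta, so M (x)_A K is the K-vector space generated
   by M modulo theta-semilinearity. *)
Inductive bc_rel : {freeg M / K} -> Prop :=
| BcAdd m m' : bc_rel (<< m + m' >> - << m >> - << m' >>)
| BcScale a m : bc_rel (<< a *: m >> - << theta a *g m >>).

Definition base_change := modquot bc_rel.
HB.instance Definition _ := GRing.Lmodule.on base_change.

Definition pure_tensor (m : M) (c : K) : base_change :=
  \pi_(modquot bc_rel) << c *g m >>.

End Object.

Variables (M N : lmodType A) (f : {linear M -> N}).

Let lift_f : {freeg M / K} -> {freeg N / K} := fglift (fun m => << f m >>).

Definition bc_map (x : base_change M) : base_change N :=
  \pi_(modquot (@bc_rel N)) (lift_f (repr x)).

Lemma bc_map_pi (x : {freeg M / K}) :
  bc_map (\pi_(modquot (@bc_rel M)) x) = \pi_(modquot (@bc_rel N)) (lift_f x).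
Proof.
apply/modquotP; rewrite /lift_f -linearB /=.
have [t [Pt ->]] := modquot_repr (@bc_rel M) x.
rewrite linear_sum /= big_seq.
apply: (big_ind (in_span (@bc_rel N))) => [||p /Pt Pp].
- exact: in_span0.
- exact: in_spanD.
rewrite linearZ; apply/in_spanZ/in_span_gen => /=.
case: Pp => [m m'|a m]; rewrite !linearB /= !liftU !scale1r.
  by rewrite (linearD f); constructor.
by rewrite (linearZ_LR f) freegZU mulr1; constructor.
Qed.

Lemma bc_map_linear : linear bc_map.
Proof.
move=> c; elim/quotW=> x; elim/quotW=> y.
by rewrite -modquot_pi_linear !bc_map_pi /lift_f linearP modquot_pi_linear.
Qed.

HB.instance Definition _ := GRing.isLinear.Build K _ _ *:%R bc_map bc_map_linear.

Lemma bc_mapE m c : bc_map (pure_tensor m c) = pure_tensor (f m) c.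
Proof. by rewrite /pure_tensor bc_map_pi /lift_f liftU freegZU mulr1. Qed.

End BaseChange.

Section Quantum.
Variables (F : fieldType) (q : F).

Definition qbrace (x : nat) : F := q ^+ x - q ^- x.
Definition qint (x : nat) : F := qbrace x / qbrace 1.
Definition qfact (m : nat) : F := \prod_(1 <= x < m.+1) qint x.
Definition qbinom (a b : nat) : F := qfact a / (qfact (a - b) * qfact b).

Lemma qfactS m : qfact m.+1 = qfact m * qint m.+1.
Proof. by rewrite /qfact big_nat_recr. Qed.

Hypothesis q0 : q != 0.
Hypothesis qN1 : forall m, q ^+ m.+1 != 1.

Lemma qbrace_neq0 m : qbrace m.+1 != 0.
Proof.
rewrite subr_eq0; apply: contra (qN1 (m + m.+1)) => /eqP h.
by rewrite -addSn exprD {1}h mulVf // expf_neq0.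
Qed.

Lemma qfact_neq0 m : qfact m != 0.
Proof.
elim: m => [|m IH]; first by rewrite /qfact big_geq // oner_neq0.
by rewrite qfactS mulf_neq0 // /qint mulf_neq0 ?invr_neq0 ?qbrace_neq0.
Qed.

Lemma qbinom0 a : qbinom (a + 0) 0 = 1.
Proof.
by rewrite /qbinom addn0 subn0 {3}/qfact big_geq // mulr1 mulfV ?qfact_neq0.
Qed.

Lemma qbinomn j : qbinom (0 + j) j = 1.
Proof.
by rewrite /qbinom add0n subnn {2}/qfact big_geq // mul1r mulfV ?qfact_neq0.
Qed.

Lemma qbinom_pascal a j :
  qbinom (a.+1 + j.+1) j.+1 =
  q ^+ j.+1 * qbinom (a + j.+1) j.+1 + q ^- a.+1 * qbinom (a.+1 + j) j.
Proof.
rewrite /qbinom !addnK (_ : a.+1 + j.+1 = (a + j.+1).+1)%N; last by rewrite addSn.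
rewrite (_ : a.+1 + j = a + j.+1)%N; last by rewrite addSnnS.
rewrite !qfactS /qint.
have := qfact_neq0 a; have := qfact_neq0 j; have := qfact_neq0 (a + j.+1).
have := qbrace_neq0 a; have := qbrace_neq0 j; have := qbrace_neq0 0.
have -> : qbrace (a + j.+1).+1 =
    q ^+ j.+1 * qbrace a.+1 + q ^- a.+1 * qbrace j.+1.
  rewrite /qbrace -addSn !exprD; field.
  by rewrite !expf_neq0.
by move=> *; field; rewrite expf_neq0 //; do !(apply/andP; split=> //).
Qed.

End Quantum.

Section MonomialFractions.
Variables (F : fieldType) (q s : F) (q0 : q != 0) (s0 : s != 0).

Lemma monomial_neq0 a b : q ^+ a * s ^+ b != 0.
Proof. by rewrite mulf_neq0 ?expf_neq0. Qed.

Lemma monomial_fracB x y a b a' b' :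
  x / (q ^+ a * s ^+ b) - y / (q ^+ a' * s ^+ b') =
  (x * (q ^+ a' * s ^+ b') - y * (q ^+ a * s ^+ b)) /
    (q ^+ (a + a') * s ^+ (b + b')).
Proof. by rewrite !exprD; field; rewrite !expf_neq0. Qed.

Lemma monomial_fracM x y a b a' b' :
  (x / (q ^+ a * s ^+ b)) * (y / (q ^+ a' * s ^+ b')) =
  x * y / (q ^+ (a + a') * s ^+ (b + b')).
Proof. by rewrite !exprD; field; rewrite !expf_neq0. Qed.

End MonomialFractions.

(* Realised inside the fraction field of Z[q][s] as the subring of the
   fractions whose denominator is a monomial. *)
Definition fracQS := {fraction {poly {poly int}}}.
HB.instance Definition _ := GRing.Field.on fracQS.

Definition qF : fracQS := tofrac 'X%:P.
Definition sF : fracQS := tofrac 'X.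

Definition laurent_pred : {pred fracQS} := fun x =>
  `[< exists (p : {poly {poly int}}) (a b : nat),
        x = tofrac p / (qF ^+ a * sF ^+ b) >].

Lemma qF_neq0 : qF != 0.
Proof. by rewrite tofrac_eq0 polyC_eq0 polyX_eq0. Qed.

Lemma sF_neq0 : sF != 0.
Proof. by rewrite tofrac_eq0 polyX_eq0. Qed.

Lemma qF_pow_neq1 m : qF ^+ m.+1 != 1.
Proof.
rewrite -tofracXn -tofrac1 tofrac_eq -rmorphXn /= -polyC1 (inj_eq polyC_inj).
apply/eqP => /(congr1 (fun p : {poly int} => size p)).
by rewrite size_polyXn size_poly1.
Qed.

Lemma monomialF a b : qF ^+ a * sF ^+ b = tofrac ('X%:P ^+ a * 'X ^+ b).
Proof. by rewrite /qF /sF tofracM !tofracXn. Qed.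

Lemma laurent_subring_closed : subring_closed laurent_pred.
Proof.
split.
- by apply/asboolP; exists 1, 0%N, 0%N; rewrite !expr0 tofrac1 !mulr1 divr1.
- move=> x y /asboolP[p [a [b ->]]] /asboolP[p' [a' [b' ->]]]; apply/asboolP.
  exists (p * ('X%:P ^+ a' * 'X ^+ b') - p' * ('X%:P ^+ a * 'X ^+ b)).
  exists (a + a')%N, (b + b')%N; rewrite (monomial_fracB qF_neq0 sF_neq0).
  by rewrite tofracB !(tofracM p) !(tofracM p') -!monomialF.
- move=> x y /asboolP[p [a [b ->]]] /asboolP[p' [a' [b' ->]]]; apply/asboolP.
  exists (p * p'), (a + a')%N, (b + b')%N.
  by rewrite (monomial_fracM qF_neq0 sF_neq0) tofracM.
Qed.

HB.instance Definition _ :=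
  GRing.isSubringClosed.Build fracQS laurent_pred laurent_subring_closed.

Record laurent := MkLaurent { laurent_val :> fracQS; _ : laurent_val \in laurent_pred }.

HB.instance Definition _ := [isSub for laurent_val].
HB.instance Definition _ := [Choice of laurent by <:].
HB.instance Definition _ := [SubChoice_isSubComNzRing of laurent by <:].

Definition laurent_unit : {pred laurent} := fun x =>
  (val x != 0) && ((val x)^-1 \in laurent_pred).
Definition laurent_inv (x : laurent) : laurent := insubd x (val x)^-1.

Lemma laurent_mulV : {in laurent_unit, left_inverse 1 laurent_inv *%R}.
Proof.
move=> x /andP[x0 xV]; apply: val_inj; rewrite rmorphM rmorph1 /=.
by rewrite /laurent_inv val_insubd xV mulVf.
Qed.

Lemma laurent_unitP (x y : laurent) : y * x = 1 -> laurent_unit x.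
Proof.
move=> /(congr1 val); rewrite rmorphM rmorph1 /= => yx.
have x0 : val x != 0.
  by apply/eqP => x0; move/eqP: yx; rewrite x0 mulr0 eq_sym oner_eq0.
by rewrite /laurent_unit x0 -[_^-1]mul1r -yx mulfK // (valP y).
Qed.

Lemma laurent_inv_out : {in [predC laurent_unit], laurent_inv =1 id}.
Proof.
move=> x; rewrite inE /laurent_unit negb_and negbK /laurent_inv => h.
apply: val_inj; rewrite val_insubd; case: ifP => // xV.
by move: h; rewrite xV orbF => /eqP ->; rewrite invr0.
Qed.

HB.instance Definition _ := GRing.ComNzRing_hasMulInverse.Build laurent
  laurent_mulV laurent_unitP laurent_inv_out.

Lemma laurent_poly_subproof p : tofrac p \in laurent_pred.
Proof. by apply/asboolP; exists p, 0%N, 0%N; rewrite !expr0 mulr1 divr1. Qed.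

Definition qL : laurent := MkLaurent (laurent_poly_subproof 'X%:P).
Definition sL : laurent := MkLaurent (laurent_poly_subproof 'X).

Lemma qL_unit : qL \is a GRing.unit.
Proof.
apply/andP; split; first exact: qF_neq0.
by apply/asboolP; exists 1, 1%N, 0%N; rewrite tofrac1 expr0 expr1 mulr1 mul1r.
Qed.

Lemma sL_unit : sL \is a GRing.unit.
Proof.
apply/andP; split; first exact: sF_neq0.
by apply/asboolP; exists 1, 0%N, 1%N; rewrite tofrac1 expr0 expr1 !mul1r.
Qed.

Lemma qbinom_laurent a j : qbinom qF (a + j) j \in laurent_pred.
Proof.
elim: a j => [|a IH] j; first by rewrite (qbinomn qF_neq0 qF_pow_neq1) rpred1.
elim: j => [|j IHj]; first by rewrite (qbinom0 qF_neq0 qF_pow_neq1) rpred1.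
rewrite (qbinom_pascal qF_neq0 qF_pow_neq1).
apply: rpredD; apply: rpredM; rewrite ?IH ?IHj //.
  by apply/rpredX/laurent_poly_subproof.
by apply/asboolP; exists 1, a.+1, 0%N; rewrite tofrac1 expr0 mulr1 mul1r.
Qed.

(* the quantum binomial coefficient [a + j, j] as a Laurent polynomial *)
Definition qbinomL (a j : nat) : laurent := MkLaurent (qbinom_laurent a j).

Section Specialization.
Variables (K : fieldType) (q0 s0 : K) (q0N : q0 != 0) (s0N : s0 != 0).

Definition ev_q : {rmorphism {poly int} -> K} :=
  horner_eval q0 \o map_poly (intr : int -> K).
Definition ev_qs : {rmorphism {poly {poly int}} -> K} :=
  horner_eval s0 \o map_poly ev_q.

Lemma ev_qsX : ev_qs 'X = s0.
Proof. by rewrite /ev_qs /= map_polyX /horner_eval hornerX. Qed.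
Lemma ev_qsXC : ev_qs 'X%:P = q0.
Proof.
by rewrite /ev_qs /= map_polyC /= map_polyX /horner_eval hornerC hornerX.
Qed.

Lemma laurent_rep (x : laurent) : exists t : {poly {poly int}} * nat * nat,
  val x = tofrac t.1.1 / (qF ^+ t.1.2 * sF ^+ t.2).
Proof. by case: x => x /= /asboolP[p [a [b ->]]]; exists (p, a, b). Qed.

Definition spec_fun (x : laurent) : K :=
  let t := sval (cid (laurent_rep x)) in ev_qs t.1.1 / (q0 ^+ t.1.2 * s0 ^+ t.2).

Lemma spec_funE (x : laurent) p a b :
  val x = tofrac p / (qF ^+ a * sF ^+ b) ->
  spec_fun x = ev_qs p / (q0 ^+ a * s0 ^+ b).
Proof.
rewrite /spec_fun; case: cid => -[[p' a'] b'] /= -> /eqP.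
have u := monomial_neq0 qF_neq0 sF_neq0.
rewrite (eqr_div _ _ (u _ _) (u _ _)) !monomialF -!tofracM tofrac_eq.
move=> /eqP /(congr1 ev_qs).
rewrite !rmorphM !rmorphXn ev_qsX ev_qsXC => h.
by apply/eqP; rewrite eqr_div ?monomial_neq0 // h.
Qed.

Lemma spec_is_zmod_morphism : zmod_morphism spec_fun.
Proof.
move=> x y; have [[[p a] b] /= hx] := laurent_rep x.
have [[[p' a'] b'] /= hy] := laurent_rep y.
rewrite (spec_funE hx) (spec_funE hy) (monomial_fracB q0N s0N).
rewrite (@spec_funE _
  (p * ('X%:P ^+ a' * 'X ^+ b') - p' * ('X%:P ^+ a * 'X ^+ b))
  (a + a')%N (b + b')%N); last first.
  rewrite rmorphB /= hx hy (monomial_fracB qF_neq0 sF_neq0).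
  by rewrite tofracB !(tofracM p) !(tofracM p') -!monomialF.
by rewrite rmorphB !rmorphM !rmorphXn ev_qsX ev_qsXC.
Qed.

Lemma spec_is_monoid_morphism : monoid_morphism spec_fun.
Proof.
split.
  rewrite (@spec_funE _ 1 0 0); first by rewrite rmorph1 !expr0 mulr1 divr1.
  by rewrite rmorph1 tofrac1 !expr0 mulr1 divr1.
move=> x y; have [[[p a] b] /= hx] := laurent_rep x.
have [[[p' a'] b'] /= hy] := laurent_rep y.
rewrite (spec_funE hx) (spec_funE hy) (@spec_funE _ (p * p') (a + a') (b + b')).
  by rewrite (monomial_fracM q0N s0N) rmorphM.
by rewrite rmorphM /= hx hy (monomial_fracM qF_neq0 sF_neq0) tofracM.
Qed.

Definition spec : {rmorphism laurent -> K} :=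
  HB.pack spec_fun
    (GRing.isZmodMorphism.Build laurent K spec_fun spec_is_zmod_morphism)
    (GRing.isMonoidMorphism.Build laurent K spec_fun spec_is_monoid_morphism).

Lemma spec_q : spec qL = q0.
Proof.
rewrite /= (@spec_funE _ 'X%:P 0 0) /= ?expr0 ?mulr1 ?divr1 //.
exact: ev_qsXC.
Qed.

Lemma spec_s : spec sL = s0.
Proof.
rewrite /= (@spec_funE _ 'X 0 0) /= ?expr0 ?mulr1 ?divr1 //.
exact: ev_qsX.
Qed.

End Specialization.

(* The basis vector e_1 (x) ... (x) e_n of V^{(x) n} is indexed by the function
   k |-> e_k; b below is the family of these basis vectors. *)
Section TensorFormulas.
Variables (A : comUnitRingType) (q s : A) (n : nat).
Variables (M : lmodType A) (b : {ffun 'I_n -> nat} -> M).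

Definition strandL (i : 'I_n.-1) : 'I_n := widen_ord (leq_pred n) i.

Lemma strandR_subproof (i : 'I_n.-1) : (i.+1 < n)%N.
Proof. by case: n i => [|m] [i hi]. Qed.
Definition strandR (i : 'I_n.-1) : 'I_n := Ordinal (strandR_subproof i).

(* the eigenvalue of K on the m-th basis vector of V *)
Definition K_eigen (m : nat) : A := s * q ^- (2 * m).

Definition lower (e : {ffun 'I_n -> nat}) (i : 'I_n) : {ffun 'I_n -> nat} :=
  [ffun k => if k == i then (e k).-1 else e k].

(* The i-th summand is the action of 1 (x) .. (x) E (x) K (x) .. (x) K with E in
   position i; it vanishes when e_i = 0, since v_{-1} = 0. *)
Definition E_basis (e : {ffun 'I_n -> nat}) : M :=
  \sum_(i < n | (0 < e i)%N)
    (\prod_(k < n | (i < k)%N) K_eigen (e k)) *: b (lower e i).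

Definition crossing (e : {ffun 'I_n -> nat}) (i : 'I_n.-1) (a : nat) :
    {ffun 'I_n -> nat} :=
  [ffun k => if k == strandL i then (e (strandR i) + a)%N
             else if k == strandR i then (e (strandL i) - a)%N
             else e k].

(* The coefficient of v_{j+a} (x) v_{i-a} in R (v_i (x) v_j); binom a j is the
   quantum binomial [a + j, j] and br m j the m-th factor of the product. *)
Definition R_coef (binom br : nat -> nat -> A) (i j a : nat) : A :=
  s ^- (i + j) * q ^+ (2 * (i - a) * (j + a)) * q ^+ ((a * (a - 1)) %/ 2) *
  binom a j * \prod_(m < a) br m j.

(* a ranges over 0, ..., bound i j *)
Definition sigma_basis (bound : nat -> nat -> nat) (binom br : nat -> nat -> A)
    (p : 'I_n.-1) (e : {ffun 'I_n -> nat}) : M :=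
  let i := e (strandL p) in let j := e (strandR p) in
  \sum_(a < (bound i j).+1) R_coef binom br i j a *: b (crossing e p a).

End TensorFormulas.

Section JacksonKerler.
Variables (n l : nat).

Definition VJK := {freeg {ffun 'I_n -> nat} / laurent}.
HB.instance Definition _ := GRing.Lmodule.on VJK.

Definition vJK (e : {ffun 'I_n -> nat}) : VJK := << e >>.

Definition EJK : {linear VJK -> VJK} := fglift (E_basis qL sL vJK).

Definition sigmaJK (p : 'I_n.-1) : {linear VJK -> VJK} :=
  fglift (sigma_basis qL sL vJK (fun i _ => i) qbinomL
    (fun m j => sL * qL ^- (m + j) - sL^-1 * qL ^+ (m + j)) p).

Definition VJK_weight : VJK -> Prop :=
  in_span (fun x => exists e : {ffun 'I_n -> nat}, (\sum_k e k = l)%N /\ x = vJK e).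

Definition WJK_pred : {pred VJK} := fun x => `[< EJK x = 0 /\ VJK_weight x >].

Lemma WJK_submod_closed : submod_closed WJK_pred.
Proof.
split; first by apply/asboolP; rewrite linear0; split=> //; apply: in_span0.
move=> a x y /asboolP[Ex Vx] /asboolP[Ey Vy]; apply/asboolP.
rewrite linearP Ex Ey scaler0 addr0; split=> //.
by apply: in_spanD => //; apply: in_spanZ.
Qed.

HB.instance Definition _ :=
  GRing.isSubmodClosed.Build laurent VJK WJK_pred WJK_submod_closed.

Record WJK := MkWJK { WJK_val :> VJK; _ : WJK_val \in WJK_pred }.

HB.instance Definition _ := [isSub for WJK_val].
HB.instance Definition _ := [Choice of WJK by <:].
HB.instance Definition _ := [SubChoice_isSubLmodule of WJK by <:].

End JacksonKerler.

Section RootOfUnity.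
Variables (R : realType) (r n : nat).

Definition q_root : R[i] := (cos (pi / r%:R) +i* sin (pi / r%:R))%C.
Definition s_root : R[i] := q_root ^+ (r - 1).

Lemma q_root_neq0 : q_root != 0.
Proof.
apply/eqP => -[c0 s0]; have := cos2Dsin2 (pi / r%:R : R).
by rewrite c0 s0 expr0n addr0 => /esym/eqP; rewrite oner_eq0.
Qed.

Lemma s_root_neq0 : s_root != 0.
Proof. by rewrite expf_neq0 ?q_root_neq0. Qed.

(* the space of coordinate vectors of V^{(x) n} in the basis of tensors of the
   u_0, ..., u_{r-1} *)
Definition Vroot := {ffun {ffun 'I_n -> 'I_r} -> R[i]^o}.
HB.instance Definition _ := Vector.on Vroot.

(* zero as soon as some e_k >= r, in accordance with u_r = 0 *)
Definition uroot (e : {ffun 'I_n -> nat}) : Vroot :=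
  [ffun t : {ffun 'I_n -> 'I_r} => ([forall k, t k == e k :> nat])%:R].

Definition exps (t : {ffun 'I_n -> 'I_r}) : {ffun 'I_n -> nat} :=
  [ffun k => nat_of_ord (t k)].

Definition linear_ext (f : {ffun 'I_n -> nat} -> Vroot) (x : Vroot) : Vroot :=
  \sum_t (x t : R[i]) *: f (exps t).

Lemma linear_ext_linear f : linear (linear_ext f).
Proof.
move=> a x y; rewrite /linear_ext scaler_sumr -big_split /=.
by apply: eq_bigr => t _; rewrite !ffunE scalerDl scalerA.
Qed.

HB.instance Definition _ f :=
  GRing.isLinear.Build R[i] Vroot Vroot *:%R (linear_ext f)
    (linear_ext_linear f).

Definition Eroot : 'End(Vroot) :=
  linfun (linear_ext (E_basis q_root s_root uroot)).

Definition sigma_root (p : 'I_n.-1) : 'End(Vroot) :=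
  linfun (linear_ext (sigma_basis q_root s_root uroot
    (fun i j => minn i (r - j - 1)) (fun a j => qbinom q_root (a + j) j)
    (fun m j => qbrace q_root (m + j + 1)) p)).

Definition Vroot_weight (l : nat) : {vspace Vroot} :=
  span [seq uroot (exps t) | t : {ffun 'I_n -> 'I_r} <- enum {ffun 'I_n -> 'I_r}
                           & (\sum_k t k == l)%N].

Definition Wroot (l : nat) : {vspace Vroot} :=
  (lker Eroot :&: Vroot_weight l)%VS.

Definition spec_root : {rmorphism laurent -> R[i]} :=
  spec q_root_neq0 s_root_neq0.

End RootOfUnity.

(* Main.v *)
(* Represent a vector by its coefficient function x on exponents e in N^n.
   There E reads (E x)(e) = \sum_i K_{>i}(e) x(e + delta_i), without boundary
   conditions, and sigma_p is a sum over a <= e_p. That sigma_p commutes with E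
   is a three-term recursion for the coefficients of R. Since E contains an
   invertible multiple of raising e_p, an operator commuting with the action of
   E on the strands p, p+1, p+2 is determined by its values at e_p = 0; both
   sides of the braid relation commute with it and trivially agree there.

   The last exponent is raised by E with coefficient 1, so an element of ker E
   is determined by its coefficients at e_n = 0, which can be prescribed freely.
   Hence in weight l the kernel is free on the 'C(n + l - 2, l) exponents with
   e_n = 0, over L as well as over C, compatibly with specialization. Finally,
   as l < r, in weight l the truncation at u_r is never seen, and the quantum
   binomials that occur have nonvanishing denominators at the root of unity. *)
Require Import Defs.
From HB Require Import structures.
From mathcomp Require Import all_boot all_order all_algebra.
From mathcomp Require Import boolp reals trigo.
From mathcomp Require Import ring zify.
From mathcomp Require Import complex.
From mathcomp.multinomials Require Import freeg.
Set Implicit Arguments.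
Unset Strict Implicit.
Unset Printing Implicit Defensive.
Import Order.TTheory GRing.Theory Num.Theory.
Local Open Scope ring_scope.
Local Open Scope quotient_scope.

(** * Operators on coefficient functions *)

Section Exponents.
Variable n : nat.
Local Notation expo := {ffun 'I_n -> nat}.
Implicit Types (e f : expo) (p : 'I_n.-1).

Definition raise e (i : 'I_n) : expo :=
  [ffun k => if k == i then (e k).+1 else e k].

Definition wt e : nat := (\sum_k e k)%N.

Lemma strandR_neqL p : (strandR p == strandL p) = false.
Proof. by apply/eqP => /(congr1 val) /= /eqP; rewrite eqn_leq ltnn. Qed.

Lemma strandL_neqR p : (strandL p == strandR p) = false.
Proof. by rewrite eq_sym strandR_neqL. Qed.

Lemma crossingL e p a : crossing e p a (strandL p) = (e (strandR p) + a)%N.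
Proof. by rewrite ffunE eqxx. Qed.

Lemma crossingR e p a : crossing e p a (strandR p) = (e (strandL p) - a)%N.
Proof. by rewrite ffunE strandR_neqL eqxx. Qed.

Lemma crossingN e p a k : k != strandL p -> k != strandR p ->
  crossing e p a k = e k.
Proof. by move=> /negPf kL /negPf kR; rewrite ffunE kL kR. Qed.

Lemma crossingK e p a : (a <= e (strandL p))%N ->
  crossing (crossing e p a) p a = e.
Proof.
move=> ha; apply/ffunP => k; rewrite ffunE crossingL crossingR.
case: eqP => [->|/eqP kL]; first by rewrite subnK.
by case: eqP => [->|/eqP kR]; rewrite ?addnK // crossingN.
Qed.

(** This transposes the matrix of sigma_p: for fixed [a], [crossing] is an involution on the
    exponents with a <= e_p. *)
Lemma crossing_eq e f p a :
  ((a <= e (strandL p))%N && (crossing e p a == f)) =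
  ((a <= f (strandL p))%N && (e == crossing f p a)).
Proof.
apply/andP/andP => -[ha /eqP ef].
  by rewrite -ef crossingL leq_addl crossingK.
by rewrite ef crossingL leq_addl crossingK.
Qed.

Lemma wt_crossing e p a : (a <= e (strandL p))%N -> wt (crossing e p a) = wt e.
Proof.
move=> ha; rewrite /wt.
rewrite (bigD1 (strandL p)) //= (bigD1 (strandR p)) ?strandR_neqL //=.
rewrite [in RHS](bigD1 (strandL p)) //= [in RHS](bigD1 (strandR p)) ?strandR_neqL //=.
rewrite crossingL crossingR !addnA; congr (_ + _)%N.
  by rewrite -addnA subnKC // addnC.
by apply: eq_bigr => k /andP[kL kR]; rewrite crossingN.
Qed.

Lemma wt_raise e i : wt (raise e i) = (wt e).+1.
Proof.
rewrite /wt (bigD1 i) //= [in RHS](bigD1 i) //= ffunE eqxx addSn.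
by congr (_ + _).+1; apply: eq_bigr => k /negPf ki; rewrite ffunE ki.
Qed.

Lemma raise_lower e i : (0 < e i)%N -> raise (lower e i) i = e.
Proof.
by move=> h; apply/ffunP => k; rewrite !ffunE; case: eqP => // ->; rewrite prednK.
Qed.

Lemma lower_raise e i : lower (raise e i) i = e.
Proof. by apply/ffunP => k; rewrite !ffunE; case: eqP. Qed.

Lemma lower_eq e f i : ((0 < e i)%N && (lower e i == f)) = (e == raise f i).
Proof.
apply/andP/eqP => [[h /eqP <-]|->]; first by rewrite raise_lower.
by rewrite lower_raise ffunE eqxx.
Qed.

Lemma leq_wt e k : (e k <= wt e)%N.
Proof. by rewrite /wt (bigD1 k) //= leq_addr. Qed.

End Exponents.

(** * E and sigma_p on coefficient functions, and their commutation *)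

Section CoefficientFunctions.
Variables (A : comUnitRingType) (q s : A) (n : nat).
Local Notation expo := {ffun 'I_n -> nat}.
Implicit Types (e f : expo) (p : 'I_n.-1) (x : expo -> A) (P : pred 'I_n).

Definition Kabove P e (i : 'I_n) : A :=
  \prod_(k | P k && (i < k)%N) K_eigen q s (e k).

(* The action of E on the tensor factors in P, on coefficient functions. *)
Definition Ecoef P x e : A := \sum_(i | P i) Kabove P e i * x (raise e i).

(** Here sigma_p is read off by rows: [D y z a] stands for the coefficient with which v_{z+a} (x)
    v_{y-a} contributes to v_y (x) v_z. It is kept abstract, because the commutation and braid
    relations follow from the recursion imposed on [D] below. *)
Definition sigma_coef (D : nat -> nat -> nat -> A) p x e : A :=
  \sum_(a < (e (strandL p)).+1)
    D (e (strandL p)) (e (strandR p)) a * x (crossing e p a).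

Lemma KaboveR P e p :
  P (strandR p) ->
  Kabove P e (strandL p) = K_eigen q s (e (strandR p)) * Kabove P e (strandR p).
Proof.
move=> PR; rewrite /Kabove (bigD1 (strandR p)) /= ?PR ?ltnSn //.
congr (_ * _); apply: eq_bigl => k; rewrite -andbA; congr (_ && _).
by rewrite [RHS]ltn_neqAle eq_sym andbC.
Qed.

Lemma Kabove_eq P e f (i : 'I_n) :
  (forall k : 'I_n, (i < k)%N -> e k = f k) -> Kabove P e i = Kabove P f i.
Proof. by move=> h; apply: eq_bigr => k /andP[_ /h ->]. Qed.

Lemma K_eigenM y z :
  K_eigen q s y * K_eigen q s z = s ^+ 2 * q^-1 ^+ (2 * (y + z)).
Proof. by rewrite /K_eigen -!exprVn mulrACA -expr2 -exprD mulnDr. Qed.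

(** For [i] left of the pair, the two strands enter only through K_y K_z, which depends on y + z
    alone, and a crossing preserves this sum. For [i] to the right nothing changes. *)
Lemma Kabove_crossing P e p a i :
  P (strandL p) -> P (strandR p) -> (a <= e (strandL p))%N ->
  i != strandL p -> i != strandR p -> Kabove P (crossing e p a) i = Kabove P e i.
Proof.
move=> PL PR ha iL iR; have [iltL|] := ltnP i (strandL p).
  have iltR : (i < strandR p)%N by apply: ltn_trans iltL _; rewrite /= ltnSn.
  rewrite /Kabove (bigD1 (strandL p)) /= ?PL //.
  rewrite (bigD1 (strandR p)) /= ?PR ?iltR ?strandR_neqL //.
  rewrite [RHS](bigD1 (strandL p)) /= ?PL //.
  rewrite [in RHS](bigD1 (strandR p)) /= ?PR ?iltR ?strandR_neqL //.
  rewrite [LHS]mulrA [RHS]mulrA; congr (_ * _).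
    rewrite crossingL crossingR !K_eigenM; congr (_ * _ ^+ (2 * _)).
    by rewrite -addnA subnKC // addnC.
  by apply: eq_bigr => k /andP[/andP[_ kL] kR]; rewrite crossingN.
move=> Li; apply: Kabove_eq => k ik; rewrite crossingN //.
  by apply: contraTneq ik => ->; rewrite -leqNgt.
apply: contraTneq ik => ->; rewrite -leqNgt /= ltn_neqAle.
by rewrite Li andbT; apply: contra iL => /eqP h; apply/eqP/val_inj.
Qed.

Lemma crossing_raise e p a i : i != strandL p -> i != strandR p ->
  crossing (raise e i) p a = raise (crossing e p a) i.
Proof.
move=> iL iR; apply/ffunP => k; rewrite !ffunE ![strandL p == i]eq_sym.
rewrite ![strandR p == i]eq_sym (negPf iL) (negPf iR).
case: (eqVneq k (strandL p)) => [->|kL]; first by rewrite eq_sym (negPf iL).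
by case: (eqVneq k (strandR p)) => [->|kR] //; rewrite eq_sym (negPf iR).
Qed.

Section Commutation.
Variable D : nat -> nat -> nat -> A.
Hypothesis D_gt : forall y z a, (y < a)%N -> D y z a = 0.
Hypothesis D_rec0 : forall y z, K_eigen q s z * D y.+1 z 0 = D y z 0.
Hypothesis D_rec : forall y z a, (a <= y)%N ->
  K_eigen q s z * D y.+1 z a.+1 + D y z.+1 a =
  D y z a * K_eigen q s (y - a) + D y z a.+1.

(** The two-strand case of commutation with E. The coefficients of [X 0] agree by [D_rec0], those of
    [X a.+1] by [D_rec]. *)
Lemma sigma_coef_pair y z (X : nat -> A) :
  K_eigen q s z * (\sum_(a < y.+2) D y.+1 z a * X a) +
    \sum_(a < y.+1) D y z.+1 a * X a.+1 =
  \sum_(a < y.+1) D y z a * (K_eigen q s (y - a) * X a.+1 + X a).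
Proof.
under [RHS]eq_bigr do rewrite mulrDr.
rewrite big_split /= [\sum_(i < y.+1) D y z i * X i]big_ord_recl.
rewrite [\sum_(a < y.+2) _]big_ord_recl /= mulrDr mulrA D_rec0.
rewrite -addrA [RHS]addrCA; congr (_ + _).
(* The sum may be extended by one term because [D y z y.+1] vanishes. *)
have -> : \sum_(i < y) D y z (bump 0 i) * X (bump 0 i) =
    \sum_(i < y.+1) D y z i.+1 * X i.+1.
  by rewrite [RHS]big_ord_recr /= D_gt // mul0r addr0; apply: eq_bigr.
rewrite mulr_sumr -!big_split /=; apply: eq_bigr => a _.
by rewrite mulrA mulrA -!mulrDl D_rec // -ltnS.
Qed.

(** Raising a strand other than the two of [p] commutes with the crossing termwise; the two
    remaining terms form the two-strand identity times [Q]. The set [P] is general so that E can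
    later be restricted to the three strands of a braid relation. *)
Lemma Ecoef_sigma P p x e : P (strandL p) -> P (strandR p) ->
  Ecoef P (sigma_coef D p x) e = sigma_coef D p (Ecoef P x) e.
Proof.
move=> PL PR; set y := e (strandL p); set z := e (strandR p).
have RL : strandR p != strandL p by rewrite strandR_neqL.
rewrite /Ecoef (bigD1 (strandL p)) //= (bigD1 (strandR p)) ?PR //=.
rewrite /sigma_coef -/y -/z.
under [RHS]eq_bigr => a _.
  rewrite (bigD1 (strandL p)) //= (bigD1 (strandR p)) ?PR //= 2!mulrDr addrA.
  over.
rewrite !big_split /= addrA; congr (_ + _); last first.
  under [RHS]eq_bigr do rewrite mulr_sumr.
  rewrite exchange_big /=; apply: eq_bigr => i /andP[/andP[Pi iL] iR].
  rewrite !ffunE ![strandL p == i]eq_sym ![strandR p == i]eq_sym.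
  rewrite (negPf iL) (negPf iR) mulr_sumr; apply: eq_bigr => a _.
  rewrite Kabove_crossing //; last by rewrite -ltnS.
  by rewrite crossing_raise // mulrCA.
set Q := Kabove P e (strandR p).
(* Raising either strand, before or after the crossing, gives an argument of this one family,
   shifted by at most one in [a]. *)
pose X a := x (crossing (raise e (strandL p)) p a).
have XR a : x (crossing (raise e (strandR p)) p a) = X a.+1.
  congr x; apply/ffunP => k; rewrite !ffunE !eqxx strandR_neqL strandL_neqR.
  case: (eqVneq k (strandL p)) => [_|kL]; first by rewrite addSnnS.
  by case: (eqVneq k (strandR p)) => [_|kR] //; rewrite subSS.
have XLr a : x (raise (crossing e p a) (strandL p)) = X a.+1.
  congr x; apply/ffunP => k; rewrite !ffunE !eqxx strandR_neqL ?strandL_neqR.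
  case: (eqVneq k (strandL p)) => [_|kL]; first by rewrite addnS.
  by case: (eqVneq k (strandR p)) => [_|kR] //; rewrite subSS.
have XRr a : (a <= y)%N -> x (raise (crossing e p a) (strandR p)) = X a.
  move=> ay; congr x; apply/ffunP => k; rewrite !ffunE !eqxx strandR_neqL.
  case: (eqVneq k (strandL p)) => [->|kL]; first by rewrite strandL_neqR.
  by case: (eqVneq k (strandR p)) => [_|kR] //; rewrite subSn.
have KR a : Kabove P (crossing e p a) (strandR p) = Q.
  apply: Kabove_eq => k /= kR; rewrite crossingN //.
    by apply: contraTneq kR => ->; rewrite /= -leqNgt.
  by apply: contraTneq kR => ->; rewrite /= ltnn.
transitivity (Q * (K_eigen q s z * (\sum_(a < y.+2) D y.+1 z a * X a) +
    \sum_(a < y.+1) D y z.+1 a * X a.+1)).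
  rewrite (KaboveR _ PR) -/z -/Q !ffunE !eqxx strandL_neqR strandR_neqL -/y -/z.
  under [X in _ + _ * X = _]eq_bigr do rewrite XR.
  by rewrite [RHS]mulrDr mulrA [K_eigen q s z * Q]mulrC.
rewrite sigma_coef_pair mulr_sumr -big_split /=; apply: eq_bigr => a _.
rewrite (KaboveR _ PR) KR XLr XRr; last by rewrite -ltnS.
by rewrite crossingR -/y; ring.
Qed.

End Commutation.

End CoefficientFunctions.

(** * Braid relations and injectivity of sigma_p *)

Section BraidRelations.
Variables (A : comUnitRingType) (q s : A) (n : nat).
Local Notation expo := {ffun 'I_n -> nat}.
Implicit Types (e f : expo) (p : 'I_n.-1) (x : expo -> A) (P : pred 'I_n).
Hypotheses (q_unit : q \is a GRing.unit) (s_unit : s \is a GRing.unit).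

Lemma K_eigen_unit m : K_eigen q s m \is a GRing.unit.
Proof. by rewrite unitrM s_unit unitrV unitrX. Qed.

Lemma Kabove_unit P e i : Kabove q s P e i \is a GRing.unit.
Proof. by apply: rpred_prod => k _; apply: K_eigen_unit. Qed.

(* E contains an invertible multiple of the raising of any one exponent, so an
   operator commuting with E is determined by its values at exponents vanishing
   there. *)
Lemma Ecoef_commute_uniq P i0 (T T' : (expo -> A) -> expo -> A) :
  P i0 ->
  (forall x, Ecoef q s P (T x) = T (Ecoef q s P x)) ->
  (forall x, Ecoef q s P (T' x) = T' (Ecoef q s P x)) ->
  (forall x e, e i0 = 0%N -> T x e = T' x e) ->
  T =1 T'.
Proof.
move=> Pi0 ET ET' h0 x; apply: funext => e.
have [k ek] : exists k, e i0 = k by exists (e i0).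
elim: k x e ek => [|k IH] x e ek; first exact: h0.
pose f := lower e i0.
have ef : e = raise f i0 by rewrite raise_lower // ek.
have fk : f i0 = k by rewrite ffunE eqxx ek.
have := IH (Ecoef q s P x) f fk; rewrite -ET -ET' /Ecoef.
rewrite (bigD1 i0) //= [RHS](bigD1 i0) //= -ef.
rewrite [X in _ + X = _](_ : _ =
    \sum_(i < n | P i && (i != i0)) Kabove q s P f i * T' x (raise f i)).
  by move/addIr/(mulrI (Kabove_unit _ _ _)).
apply: eq_bigr => i /andP[_ ii0]; congr (_ * _); apply: IH.
by rewrite ffunE eq_sym (negPf ii0).
Qed.

Section Sigma.
Variable D : nat -> nat -> nat -> A.
Hypothesis D_00 : forall z, D 0 z 0 = s ^- z.
Hypothesis D_gt : forall y z a, (y < a)%N -> D y z a = 0.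
Hypothesis D_rec0 : forall y z, K_eigen q s z * D y.+1 z 0 = D y z 0.
Hypothesis D_rec : forall y z a, (a <= y)%N ->
  K_eigen q s z * D y.+1 z a.+1 + D y z.+1 a =
  D y z a * K_eigen q s (y - a) + D y z a.+1.
Local Notation sig := (sigma_coef D).

Lemma Ecoef_sigmaE P p x : P (strandL p) -> P (strandR p) ->
  Ecoef q s P (sig p x) = sig p (Ecoef q s P x).
Proof. by move=> PL PR; apply: funext => e; apply: Ecoef_sigma. Qed.

Lemma sigma_coefE p x e : sig p x e =
  \sum_(a < (e (strandL p)).+1)
    D (e (strandL p)) (e (strandR p)) a * x (crossing e p a).
Proof. by []. Qed.

Lemma sigma_coef0 p x e : e (strandL p) = 0%N ->
  sig p x e = s ^- e (strandR p) * x (crossing e p 0).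
Proof. by move=> e0; rewrite /sigma_coef e0 big_ord1 D_00. Qed.

Lemma sigma_coef_far (i j : 'I_n.-1) x : (i.+1 < j)%N ->
  sig i (sig j x) = sig j (sig i x).
Proof.
move=> ij; apply: funext => e; rewrite /sigma_coef.
have neq (k k' : 'I_n) : (k < k')%N -> ((k == k') = false) * ((k' == k) = false).
  by move=> kk'; rewrite eq_sym; split; apply/eqP => kE; rewrite kE ltnn in kk'.
have LL := neq (strandL i) (strandL j) (ltn_trans (ltnSn i) ij).
have LR := neq (strandL i) (strandR j) (ltn_trans (ltn_trans (ltnSn i) ij) (ltnSn j)).
have RL := neq (strandR i) (strandL j) ij.
have RR := neq (strandR i) (strandR j) (ltn_trans ij (ltnSn j)).
under eq_bigr => a _.
  rewrite !(crossingN, LL, RL, LR, RR) // mulr_sumr; over.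
under [RHS]eq_bigr => a _.
  rewrite !(crossingN, LL, RL, LR, RR) // mulr_sumr; over.
rewrite exchange_big /=; apply: eq_bigr => b _; apply: eq_bigr => a _.
rewrite mulrCA; congr (_ * (_ * x _)); apply/ffunP => k; rewrite !ffunE.
rewrite !LL !RL !LR !RR.
case: (eqVneq k (strandL i)) => [->|]; first by rewrite LL LR.
case: (eqVneq k (strandR i)) => [->|//]; first by rewrite RL RR.
Qed.

Lemma sigma_coef_near (i j : 'I_n.-1) x : i.+1 = j ->
  sig i (sig j (sig i x)) = sig j (sig i (sig j x)).
Proof.
move=> ij.
have Lj : strandL j = strandR i by apply: val_inj; rewrite /= ij.
(* Both sides commute with E restricted to these three strands, so they need comparison only where
   the exponent at [strandL i] is zero. *)
pose P : pred 'I_n := pred3 (strandL i) (strandR i) (strandR j).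
have PLi : P (strandL i) by rewrite /P /= eqxx.
have PRi : P (strandR i) by rewrite /P /= eqxx orbT.
have PLj : P (strandL j) by rewrite Lj.
have PRj : P (strandR j) by rewrite /P /= eqxx !orbT.
have LRj : (strandL i == strandR j) = false.
  by apply/eqP => /(congr1 val) /= /eqP; rewrite -ij eqn_leq ltnNge leqnSn andbF.
have RRj : (strandR i == strandR j) = false by rewrite -Lj strandL_neqR.
have EP := (Ecoef_sigmaE _ PLi PRi, Ecoef_sigmaE _ PLj PRj).
apply: (@Ecoef_commute_uniq P (strandL i)
  (fun x => sig i (sig j (sig i x))) (fun x => sig j (sig i (sig j x)))) => //.
- by move=> y; rewrite !EP.
- by move=> y; rewrite !EP.
(* The vanishing exponent travels through the crossings: on each side it collapses two of the three
   operators to their terms a = 0. The surviving sums, of [sig i] on the left and of the outer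
   [sig j] on the right, carry the same [D] and the same powers of [s]. *)
move=> {}x e e0.
have e1 a : crossing e j a (strandL i) = 0%N.
  by rewrite crossingN ?LRj // Lj strandL_neqR.
rewrite sigma_coef0 // sigma_coef0; last by rewrite Lj crossingR e0.
rewrite crossingN ?[_ == strandL i]eq_sym ?LRj // 1?eq_sym ?RRj //.
have RHSa a : (a <= e (strandL j))%N -> sig i (sig j x) (crossing e j a) =
    s ^- e (strandR i) / s ^+ e (strandR j) *
    x (crossing (crossing (crossing e j a) i 0) j 0).
  move=> ha; rewrite sigma_coef0 // sigma_coef0; last by rewrite Lj crossingR e1.
  rewrite -Lj crossingL mulrA; congr (_ * _).
  rewrite crossingN ?[_ == strandL i]eq_sym ?LRj //; last first.
    by rewrite eq_sym -Lj strandL_neqR.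
  rewrite crossingR -!exprVn -!exprD; congr (_ ^+ _).
  by rewrite -addnA subnKC // addnC.
rewrite [RHS]sigma_coefE mulrA [sig i x _]sigma_coefE mulr_sumr.
have -> : crossing (crossing e i 0) j 0 (strandL i) = e (strandL j).
  by rewrite crossingN ?LRj // ?crossingL ?addn0 Lj // strandL_neqR.
have -> : crossing (crossing e i 0) j 0 (strandR i) = e (strandR j).
  rewrite -Lj crossingL addn0 crossingN //; first by rewrite eq_sym LRj.
  by rewrite eq_sym RRj.
apply: eq_bigr => a _; rewrite RHSa; last by rewrite -ltnS.
rewrite mulrCA; congr (_ * (_ * x _)).
apply/ffunP => k; rewrite !ffunE -?Lj !eqxx.
have [LjLi RjLj] : (strandL j == strandL i) = false /\
    (strandR j == strandL j) = false by rewrite {1}Lj !strandR_neqL.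
have RjLi : (strandR j == strandL i) = false by rewrite eq_sym LRj.
rewrite !(LjLi, RjLj, RjLi, LRj, strandL_neqR) ![strandL i == _]eq_sym LjLi e0.
rewrite !addn0 !subn0.
case: (eqVneq k (strandL i)) => [->|kLi]; first by rewrite eq_sym LjLi LRj.
case: (eqVneq k (strandL j)) => // kLj.
by case: (eqVneq k (strandR j)).
Qed.

Lemma D_0_unit y z : D y z 0 \is a GRing.unit.
Proof.
elim: y => [|y IH]; first by rewrite D_00 unitrV unitrX.
by move: IH; rewrite -D_rec0 unitrM => /andP[].
Qed.

(** Triangularity in the exponent at [strandR p]: in the value at [crossing e p 0], the term a = 0
    is a unit times [x e], and the others evaluate [x] at smaller right exponents. Crossings
    preserve the weight, so the argument can be confined to the weights in [Q]. *)
Lemma sigma_coef_inj (Q : pred nat) p x :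
  (forall e, Q (wt e) -> sig p x e = 0) -> forall e, Q (wt e) -> x e = 0.
Proof.
move=> h e; have [y ey] : exists y, (e (strandR p) <= y)%N by exists (e (strandR p)).
elim: y e ey => [|y IH] e ey Qe; have wf := @wt_crossing _ e p 0 (leq0n _);
  have := h (crossing e p 0); rewrite wf => /(_ Qe);
  rewrite /sigma_coef big_ord_recl crossingK // big1 ?addr0.
- by move/eqP; rewrite mulrI_eq0; [move/eqP | apply/mulrI/D_0_unit].
- by move=> [a]; rewrite crossingL addn0 => /= ha; case: (e _) ey ha.
- by move/eqP; rewrite mulrI_eq0; [move/eqP | apply/mulrI/D_0_unit].
move=> [a]; rewrite crossingL addn0 => /= ha _; rewrite [x _]IH ?mulr0 //.
  rewrite crossingR crossingL addn0 /bump /= add1n.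
  by case: (e _) ey ha => // u uy _; rewrite subSS (leq_trans (leq_subr _ _)).
by rewrite wt_crossing ?wf // crossingL addn0.
Qed.

End Sigma.
End BraidRelations.

(** * Kernel elements of E from their coefficients at e_n = 0 *)

Section KernelExtension.
Variables (A : comUnitRingType) (q s : A) (n : nat).
Local Notation expo := {ffun 'I_n.+1 -> nat}.
Local Notation E := (Ecoef q s predT).
Implicit Types (c x : expo -> A) (e : expo).

Lemma Ecoef_last x e : E x e =
  x (raise e ord_max) +
  \sum_(i | i != ord_max) Kabove q s predT e i * x (raise e i).
Proof.
rewrite /Ecoef (bigD1 ord_max) //= /Kabove big_pred0 ?mul1r // => k.
by rewrite ltnNge -ltnS ltn_ord.
Qed.

(* The kernel condition solved for the coefficient at the raised last exponent. *)
Fixpoint ker_ext_rec c k e : A :=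
  if k is k'.+1 then
    - \sum_(i | i != ord_max) Kabove q s predT (lower e ord_max) i *
                              ker_ext_rec c k' (raise (lower e ord_max) i)
  else c e.

(** The recursion depth is the last exponent itself. Raising any other exponent keeps it fixed, so
    the recursive calls are again values of [ker_ext]. *)
Definition ker_ext c e := ker_ext_rec c (e ord_max) e.

Lemma ker_ext0 c e : e ord_max = 0%N -> ker_ext c e = c e.
Proof. by rewrite /ker_ext => ->. Qed.

Lemma Ecoef_ker_ext c e : E (ker_ext c) e = 0.
Proof.
rewrite Ecoef_last [ker_ext c (raise _ _)]/ker_ext ffunE eqxx /= lower_raise.
apply/eqP; rewrite addrC subr_eq0; apply/eqP/eq_bigr => i imax.
by rewrite /ker_ext ffunE eq_sym (negPf imax).
Qed.

Lemma ker_ext_wt c l : (forall e, wt e != l -> c e = 0) ->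
  forall e, wt e != l -> ker_ext c e = 0.
Proof.
move=> h e; rewrite /ker_ext.
have [k ek] : exists k, e ord_max = k by exists (e ord_max).
rewrite ek; elim: k e ek => [|k IH] e ek el /=; first exact: h.
rewrite big1 ?oppr0 // => i imax; rewrite IH ?mulr0 //.
  by rewrite !ffunE eqxx eq_sym (negPf imax) ek.
have er := @raise_lower _ e ord_max; rewrite ek in er.
by apply: contraNneq el => <-; rewrite -[X in wt X]er // !wt_raise.
Qed.

Lemma ker_uniq x y :
  (forall e, E x e = 0) -> (forall e, E y e = 0) ->
  (forall e, e ord_max = 0%N -> x e = y e) -> forall e, x e = y e.
Proof.
move=> Ex Ey h e; have [k ek] : exists k, e ord_max = k by exists (e ord_max).
elim: k e ek => [|k IH] e ek; first exact: h.
have er : raise (lower e ord_max) ord_max = e by rewrite raise_lower ?ek.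
have := Ey (lower e ord_max); rewrite -(Ex (lower e ord_max)) !Ecoef_last er.
set S := \sum_(i | _) _; set S' := \sum_(i | _) _; suff -> : S = S' by move/addIr.
apply: eq_bigr => i imax; rewrite IH // !ffunE eqxx eq_sym (negPf imax).
by rewrite ek.
Qed.

End KernelExtension.

(** * The recursion for the coefficients of R *)

Section DualCoefficients.
Variables (A : comUnitRingType) (q s : A) (binom br : nat -> nat -> A).

(* The coefficient of v_y (x) v_z in R (v_{z+a} (x) v_{y-a}). *)
Definition R_dual (y z a : nat) : A :=
  if (a <= y)%N then R_coef q s binom br (z + a) (y - a) a else 0.

Lemma R_dual_gt y z a : (y < a)%N -> R_dual y z a = 0.
Proof. by move=> ya; rewrite /R_dual leqNgt ya. Qed.

Lemma R_dual_addn j z a :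
  R_dual (j + a) z a = R_coef q s binom br (z + a) j a.
Proof. by rewrite /R_dual leq_addl addnK. Qed.

(** With i = z + a and j = y - a, the monomial part of the coefficient of R is s^-(z+y) q^(2zy),
    independent of [a]; this is the remaining factor. *)
Definition R_core (a j : nat) : A :=
  q ^+ ((a * (a - 1)) %/ 2) * binom a j * \prod_(m < a) br m j.

Lemma R_dualE y z a : (a <= y)%N ->
  R_dual y z a = s ^- (z + y) * q ^+ (2 * z * y) * R_core a (y - a).
Proof.
by move=> ay; rewrite /R_dual ay /R_coef /R_core addnK -addnA subnKC // subnK // !mulrA.
Qed.

End DualCoefficients.

Section FieldRecursion.
Variables (F : fieldType) (q s : F) (q0 : q != 0) (s0 : s != 0).
Hypothesis qN1 : forall m, q ^+ m.+1 != 1.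
Let binom a j := qbinom q (a + j) j.
Let br m j := s * q ^- (m + j) - s^-1 * q ^+ (m + j).
Local Notation G := (R_core q binom br).

(** Converts nonvanishing of braces into the form of the denominators that arise when fractions are
    cleared. *)
Lemma subV1_neq0 (x : F) : x - x^-1 != 0 -> x * x - 1 != 0.
Proof.
apply: contraNneq => /eqP; rewrite subr_eq0 => /eqP xx.
have x0 : x != 0 by apply: contra_eq_neq xx => ->; rewrite mul0r eq_sym oner_neq0.
by rewrite subr_eq0; apply/eqP; apply: (mulfI x0); rewrite xx mulfV.
Qed.

Lemma half_mulSn a : ((a.+1 * (a.+1 - 1)) %/ 2 = (a * (a - 1)) %/ 2 + a)%N.
Proof. by rewrite !subn1 !divn2 -!bin2 binS bin1. Qed.

Lemma R_core_rec0 a : G a.+1 0 = (s - s^-1 * q ^+ (2 * a)) * G a 0.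
Proof.
rewrite /R_core half_mulSn exprD big_ord_recr /= /binom /br !qbinom0 //.
by rewrite addn0 mul2n -addnn exprD; field; rewrite s0 expf_neq0.
Qed.

(** As [br m j] depends only on m + j, the three products share the factor [P]. What remains is a
    Pascal-type identity of quantum binomials, rational in u = q^a and v = q^j. *)
Lemma R_core_rec a j :
  G a.+1 j.+1 = G a.+1 j +
    (s * q ^- (2 * j.+1) - s^-1 * q ^+ (2 * (a + j.+1))) * G a j.+1.
Proof.
rewrite /R_core half_mulSn exprD big_ord_recr [in RHS]big_ord_recl /=.
have -> : \prod_(i < a) br (bump 0 i) j = \prod_(i < a) br i j.+1.
  by apply: eq_bigr => i _; rewrite /br addnS.
set P := \prod_(_ < _) _; rewrite /binom /br /qbinom !addnK add0n.
rewrite !addSn !addnS !qfactS /qint.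
have := qfact_neq0 q0 qN1 a; have := qfact_neq0 q0 qN1 j.
have := qfact_neq0 q0 qN1 (a + j).
have := qbrace_neq0 q0 qN1 a; have := qbrace_neq0 q0 qN1 j.
have := qbrace_neq0 q0 qN1 0; have := qbrace_neq0 q0 qN1 (a + j).
rewrite /qbrace !mul2n -!addnn !(exprD, exprS) ?expr0 ?mulr1.
have := expf_neq0 a q0; have := expf_neq0 j q0.
move: (q ^+ a) (q ^+ j) => u v.
move=> v0 u0 _ /subV1_neq0 h1 /subV1_neq0 h2 /subV1_neq0 h3 aj0 j0 a0.
by field; rewrite q0 s0 u0 v0 j0 a0 h1 // h2 ?mulf_neq0 // h3 mulf_neq0.
Qed.

Local Notation D := (R_dual q s binom br).

Lemma R_dual_field_00 z : D 0 z 0 = s ^- z.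
Proof.
rewrite R_dualE // addn0 muln0 expr0 mulr1 /R_core div0n expr0 big_ord0.
by rewrite /binom qbinom0 // !mulr1.
Qed.

Lemma R_dual_field_rec0 y z : K_eigen q s z * D y.+1 z 0 = D y z 0.
Proof.
rewrite !R_dualE // !subn0 /R_core /binom !qbinomn // !big_ord0 !mulr1.
rewrite /K_eigen addnS mulnS exprD exprS; field.
by rewrite s0 !expf_neq0.
Qed.

Lemma R_dual_field_rec y z a : (a <= y)%N ->
  K_eigen q s z * D y.+1 z a.+1 + D y z.+1 a =
  D y z a * K_eigen q s (y - a) + D y z a.+1.
Proof.
(* For a = y the term [D y z a.+1] is zero and [R_core_rec0] applies; for a < y it is [R_core_rec],
   multiplied by the common monomials. *)
move=> ay; rewrite -(subnK ay) addnK; case: (y - a)%N => [|j].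
  rewrite add0n [D a z a.+1]R_dual_gt // !R_dualE // !subnn R_core_rec0.
  rewrite /K_eigen !addnS !addSn muln0 [(2 * z.+1)%N]mulnS mulnDl.
  rewrite ![(2 * z * _.+1)%N]mulnS !(exprD, exprS) ?expr0 ?mulr1; field.
  by rewrite s0 oner_neq0 !expf_neq0.
rewrite addSn; have e2 : ((j + a).+1 - a = j.+1)%N by rewrite -addSn addnK.
rewrite !R_dualE ?ltnS ?leq_addl ?leqW ?leq_addl // !subSS e2 addnK R_core_rec.
rewrite /K_eigen -addnS [(j + _)%N]addnC addSnnS.
rewrite !addnS [(2 * z.+1)%N]mulnS [((2 + _) * _)%N]mulnDl [(2 * z * _.+1)%N]mulnS.
set w := (a + j.+1)%N; set k := (2 * j.+1)%N; rewrite !(exprD, exprS).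
by field; rewrite s0 q0 !expf_neq0.
Qed.
End FieldRecursion.

(** * Transfer of the recursion to Laurent polynomials *)

Section LaurentRecursion.

Definition RL_dual : nat -> nat -> nat -> laurent :=
  R_dual qL sL qbinomL
    (fun m j => sL * qL ^- (m + j) - sL^-1 * qL ^+ (m + j)).

(** Laurent identities are checked in the fraction field, where the quotients of quantum factorials
    live; this inclusion is injective. *)
Definition laurent_frac : {rmorphism laurent -> fracQS} := val.
Local Notation iota := laurent_frac.

Lemma laurent_frac_inj : injective iota. Proof. exact: val_inj. Qed.

Lemma rmorphVX (B : comUnitRingType) (f : {rmorphism laurent -> B}) x k :
  x \is a GRing.unit -> f (x ^- k) = f x ^- k.
Proof. by move=> ux; rewrite rmorphV ?unitrX // rmorphXn. Qed.

Lemma laurent_frac_K_eigen m : iota (K_eigen qL sL m) = K_eigen qF sF m.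
Proof. by rewrite rmorphM rmorphVX ?qL_unit. Qed.

Lemma laurent_frac_RL_dual y z a : iota (RL_dual y z a) =
  R_dual qF sF (fun a j => qbinom qF (a + j) j)
    (fun m j => sF * qF ^- (m + j) - sF^-1 * qF ^+ (m + j)) y z a.
Proof.
rewrite /RL_dual /R_dual; case: ifP => _; last exact: rmorph0.
rewrite /R_coef !rmorphM !rmorphXn rmorph_prod rmorphVX ?sL_unit //.
congr (_ * _); apply: eq_bigr => m _; rewrite rmorphB !rmorphM rmorphXn.
by rewrite rmorphVX ?qL_unit // rmorphV ?sL_unit.
Qed.

Lemma RL_dual_00 z : RL_dual 0 z 0 = sL ^- z.
Proof.
apply: laurent_frac_inj; rewrite laurent_frac_RL_dual rmorphVX ?sL_unit //.
by rewrite (R_dual_field_00 _ qF_neq0 qF_pow_neq1).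
Qed.

Lemma RL_dual_gt y z a : (y < a)%N -> RL_dual y z a = 0.
Proof. exact: R_dual_gt. Qed.

Lemma RL_dual_rec0 y z : K_eigen qL sL z * RL_dual y.+1 z 0 = RL_dual y z 0.
Proof.
apply: laurent_frac_inj; rewrite rmorphM laurent_frac_K_eigen.
rewrite !laurent_frac_RL_dual.
exact: (R_dual_field_rec0 qF_neq0 sF_neq0 qF_pow_neq1).
Qed.

Lemma RL_dual_rec y z a : (a <= y)%N ->
  K_eigen qL sL z * RL_dual y.+1 z a.+1 + RL_dual y z.+1 a =
  RL_dual y z a * K_eigen qL sL (y - a) + RL_dual y z a.+1.
Proof.
move=> ay; apply: laurent_frac_inj; rewrite !rmorphD.
rewrite (rmorphM _ (K_eigen _ _ _)) (rmorphM _ (RL_dual _ _ _)).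
rewrite !laurent_frac_K_eigen !laurent_frac_RL_dual.
exact: (R_dual_field_rec qF_neq0 sF_neq0 qF_pow_neq1).
Qed.

End LaurentRecursion.

(** * The Jackson-Kerler representation *)

Section TransposedSums.
Variables (A : comUnitRingType) (q s : A) (n : nat).
Local Notation expo := {ffun 'I_n -> nat}.
Implicit Types (e f : expo) (p : 'I_n.-1).

(** Passage from columns to rows: on the left the coefficient at [f] of the image of the basis
    vector [e], on the right the row of [f] evaluated on the indicator of [e]. *)
Lemma sigma_row_col (C : nat -> nat -> nat -> A) p e f :
  \sum_(a < (e (strandL p)).+1)
    C (e (strandL p)) (e (strandR p)) a * (crossing e p a == f)%:R =
  \sum_(a < (f (strandL p)).+1)
    C (f (strandR p) + a)%N (f (strandL p) - a)%N a * (e == crossing f p a)%:R.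
Proof.
(* Over a common range of [a], [crossing_eq] matches the nonzero terms one by one. *)
set N := (maxn (e (strandL p)).+1 (f (strandL p)).+1).
rewrite (big_ord_widen N (fun a => C (e (strandL p)) (e (strandR p)) a *
  (crossing e p a == f)%:R)) ?leq_maxl //.
rewrite (big_ord_widen N (fun a => C (f (strandR p) + a)%N (f (strandL p) - a)%N a *
  (e == crossing f p a)%:R)) ?leq_maxr //.
rewrite big_mkcond [RHS]big_mkcond; apply: eq_bigr => a _; rewrite !ltnS.
have := crossing_eq e f p a.
case: leqP => ha /=; case: leqP => hb //=.
- move=> ->; case: eqP => [->|]; last by rewrite !mulr0.
  by rewrite crossingL crossingR.
- by move=> ->; rewrite mulr0.
- by move=> <-; rewrite mulr0.
Qed.

Lemma E_row_col e f :
  \sum_(i < n | (0 < e i)%N)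
    (\prod_(k < n | (i < k)%N) K_eigen q s (e k)) * (lower e i == f)%:R =
  Ecoef q s predT (fun g => (e == g)%:R) f.
Proof.
rewrite big_mkcond; apply: eq_bigr => i _; have := lower_eq e f i.
case: ltnP => _ /=; last by move=> <-; rewrite mulr0.
move=> ->; case: eqP => [->|]; last by rewrite !mulr0.
rewrite !mulr1 /Kabove; apply: eq_bigr => k ik.
by rewrite ffunE; case: eqP => // ki; rewrite ki ltnn in ik.
Qed.

Lemma exps_inj r : injective (@exps r n).
Proof.
move=> t t' tt'; apply/ffunP => k; apply: val_inj.
by have := congr1 (fun g : expo => g k) tt'; rewrite !ffunE.
Qed.

Lemma exps_surj l r g : (l < r)%N -> wt g = l -> exists t, @exps r n t = g.
Proof.
move=> lr gl; have gr k : (g k < r)%N by rewrite (leq_ltn_trans (leq_wt g k)) ?gl.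
by exists [ffun k => Ordinal (gr k)]; apply/ffunP => k; rewrite !ffunE.
Qed.

(** In weight l < r every entry of an exponent is below [r], so summing over the truncated exponents
    loses no value of [x]. *)
Lemma sum_exps l r (x : expo -> A) g : (l < r)%N ->
  (forall e, wt e != l -> x e = 0) ->
  \sum_t x (@exps r n t) * (exps t == g)%:R = x g.
Proof.
move=> lr xl; have [/(exps_surj lr)[t <-]|gl] := eqVneq (wt g) l.
  rewrite (bigD1 t) //= eqxx mulr1 big1 ?addr0 // => t' tt'.
  by rewrite (inj_eq (@exps_inj r)) (negPf tt') mulr0.
rewrite xl // big1 // => t _; case: eqP => [->|]; last by rewrite mulr0.
by rewrite xl ?mul0r.
Qed.

End TransposedSums.

(** * Coefficients of vectors in the Jackson-Kerler module *)

Section JacksonKerlerCoefficients.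
Variable n : nat.
Local Notation expo := {ffun 'I_n -> nat}.
Implicit Types (e f : expo) (p : 'I_n.-1) (x y : VJK n).

Definition cf x : expo -> laurent := fun e => coeff e x.

Lemma cfP a x y e : cf (a *: x + y) e = a * cf x e + cf y e.
Proof. by rewrite /cf coeffD coeffZ. Qed.

Lemma cfZ a x e : cf (a *: x) e = a * cf x e.
Proof. exact: coeffZ. Qed.

Lemma cf0 e : cf 0 e = 0. Proof. exact: coeff0. Qed.

Lemma cf_sum (I : Type) (r : seq I) (P : pred I) (F : I -> VJK n) e :
  cf (\sum_(i <- r | P i) F i) e = \sum_(i <- r | P i) cf (F i) e.
Proof. exact: (raddf_sum (coeff e)). Qed.

Lemma cf_vJK e f : cf (vJK e) f = (e == f)%:R.
Proof. by rewrite /cf coeffU mul1r. Qed.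

Lemma cf_inj x y : cf x =1 cf y -> x = y.
Proof. by move=> xy; apply/eqP/freeg_eqP. Qed.

Lemma VJK_sumE x : x = \sum_(e <- dom x) cf x e *: vJK e.
Proof.
rewrite -[LHS]freeg_sumE; apply: eq_bigr => e _.
by rewrite /vJK freegZU mulr1.
Qed.

Lemma VJK_ind (P : VJK n -> Prop) :
  P 0 -> (forall a x y, P x -> P y -> P (a *: x + y)) ->
  (forall e, P (vJK e)) -> forall x, P x.
Proof.
move=> P0 PD Pv x; rewrite [x]VJK_sumE; elim: (dom x) => [|e r IH].
  by rewrite big_nil.
by rewrite big_cons; apply: PD.
Qed.

Lemma EcoefP (P : pred 'I_n) a (x y z : expo -> laurent) e :
  (forall f, z f = a * x f + y f) ->
  Ecoef qL sL P z e = a * Ecoef qL sL P x e + Ecoef qL sL P y e.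
Proof.
move=> h; rewrite mulr_sumr -big_split; apply: eq_bigr => i _ /=.
by rewrite h mulrDr mulrCA.
Qed.

Lemma sigma_coefP (A : comUnitRingType) D p a (x y z : expo -> A) e :
  (forall f, z f = a * x f + y f) ->
  sigma_coef D p z e = a * sigma_coef D p x e + sigma_coef D p y e.
Proof.
move=> h; rewrite mulr_sumr -big_split; apply: eq_bigr => i _ /=.
by rewrite h mulrDr mulrCA.
Qed.

Lemma cf_EJK x e : cf (EJK n x) e = Ecoef qL sL predT (cf x) e.
Proof.
move: x e; apply: VJK_ind => [e|a x y IHx IHy e|g e].
- by rewrite linear0 /Ecoef cf0 big1 // => i _; rewrite cf0 mulr0.
- by rewrite linearP cfP IHx IHy; apply/esym/EcoefP => f; rewrite cfP.
rewrite [EJK n _](@liftU _ _ _ _ 1) scale1r /E_basis cf_sum.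
rewrite [RHS](_ : _ = Ecoef qL sL predT (fun f => (g == f)%:R) e); last first.
  by apply: eq_bigr => i _; rewrite -cf_vJK.
rewrite -E_row_col; apply: eq_bigr => i _.
by rewrite cfZ cf_vJK.
Qed.

(** By linearity it suffices to treat basis vectors, where this is the transposition
    [sigma_row_col]. *)
Lemma cf_sigmaJK p x e : cf (sigmaJK p x) e = sigma_coef RL_dual p (cf x) e.
Proof.
move: x e; apply: VJK_ind => [e|a x y IHx IHy e|g e].
- by rewrite linear0 /sigma_coef cf0 big1 // => i _; rewrite cf0 mulr0.
- by rewrite linearP cfP IHx IHy; apply/esym/sigma_coefP => f; rewrite cfP.
rewrite [sigmaJK p _](@liftU _ _ _ _ 1) scale1r /sigma_basis /= cf_sum.
under eq_bigr => a _ do rewrite cfZ cf_vJK.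
rewrite sigma_row_col; apply: eq_bigr => a _; rewrite cf_vJK.
by rewrite /RL_dual /R_dual -ltnS ltn_ord.
Qed.

Lemma VJK_weightP l x : VJK_weight l x <-> forall e, wt e != l -> cf x e = 0.
Proof.
split=> [[t [Pt ->]] e el|h].
  rewrite cf_sum big_seq big1 // => p /Pt[g [gl ->]].
  rewrite cfZ cf_vJK; case: eqP => [ge|]; last by rewrite mulr0.
  by rewrite -ge /wt gl eqxx in el.
exists [seq (cf x e, vJK e) | e <- dom x].
split; last by rewrite [RHS]big_map -VJK_sumE.
move=> p /mapP[e]; rewrite mem_dom => xe ->; exists e; split=> //.
by apply/eqP; apply: contraNT xe => el; apply/eqP/h.
Qed.

End JacksonKerlerCoefficients.

(** * The kernel of E as a representation of the braid group *)

Section BraidAction.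
Variables n l : nat.
Local Notation expo := {ffun 'I_n -> nat}.
Local Notation W := (WJK n l).
Implicit Types (e f : expo) (p : 'I_n.-1) (x y : VJK n).

Lemma WJK_predP x : reflect
  ((forall e, Ecoef qL sL predT (cf x) e = 0) /\
   (forall e, wt e != l -> cf x e = 0))
  (x \in WJK_pred l).
Proof.
rewrite unfold_in /WJK_pred; apply: (iffP (asboolP _)) => -[Ex xl];
  split; try exact/VJK_weightP.
  by move=> e; rewrite -cf_EJK Ex cf0.
by apply: cf_inj => e; rewrite cf_EJK Ex cf0.
Qed.

Lemma cf_WJK_wt (w : W) e : wt e != l -> cf (val w) e = 0.
Proof. by move: e; have /WJK_predP[] := valP w. Qed.

Lemma cf_WJK_E (w : W) e : Ecoef qL sL predT (cf (val w)) e = 0.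
Proof. by have /WJK_predP[] := valP w. Qed.

Lemma cf_sigmaJKE p x : cf (sigmaJK p x) = sigma_coef RL_dual p (cf x).
Proof. by apply: funext => e; apply: cf_sigmaJK. Qed.

Lemma sigmaJK_Ecoef p x e :
  Ecoef qL sL predT (cf (sigmaJK p x)) e =
  sigma_coef RL_dual p (Ecoef qL sL predT (cf x)) e.
Proof.
rewrite cf_sigmaJKE.
by apply: (Ecoef_sigma RL_dual_gt RL_dual_rec0 RL_dual_rec).
Qed.

Lemma sigma_coef_wt (A : comUnitRingType) D p (x : expo -> A) :
  (forall e, wt e != l -> x e = 0) ->
  forall e, wt e != l -> sigma_coef D p x e = 0.
Proof.
move=> xl e el; rewrite /sigma_coef big1 // => a _; rewrite xl ?mulr0 //.
by rewrite wt_crossing // -ltnS.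
Qed.

Lemma sigmaJK_WJK p x : x \in WJK_pred l -> sigmaJK p x \in WJK_pred l.
Proof.
move=> /WJK_predP[Ex xl]; apply/WJK_predP; split=> e.
  by rewrite sigmaJK_Ecoef /sigma_coef big1 // => a _; rewrite Ex mulr0.
by rewrite cf_sigmaJK; apply: sigma_coef_wt.
Qed.

Lemma sigmaJK_inj p : injective (sigmaJK p).
Proof.
move=> x y xy; apply: cf_inj => e; apply/eqP; rewrite -subr_eq0; apply/eqP.
have := @sigma_coef_inj _ qL sL n sL_unit _ RL_dual_00 RL_dual_rec0 predT p
  (cf (x - y)) _ e isT.
rewrite /cf coeffB; apply=> f _; rewrite -[sigma_coef _ _ _ _]cf_sigmaJK.
by rewrite linearB xy subrr cf0.
Qed.

Lemma VJK_weightZD a x y :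
  VJK_weight l x -> VJK_weight l y -> VJK_weight l (a *: x + y).
Proof. by move=> xl yl; apply: in_spanD yl; apply: in_spanZ. Qed.

Lemma sigmaJK_vJK p e : sigmaJK p (vJK e) =
  \sum_(a < (e (strandL p)).+1)
    RL_dual (e (strandR p) + a) (e (strandL p) - a) a *: vJK (crossing e p a).
Proof.
rewrite [LHS](@liftU _ _ _ _ 1) scale1r; apply: eq_bigr => a _.
have ha : (a <= e (strandL p))%N by rewrite -ltnS.
have := R_dual_addn qL sL qbinomL
  (fun m j => sL * qL ^- (m + j) - sL^-1 * qL ^+ (m + j))
  (e (strandR p)) (e (strandL p) - a) a.
rewrite (subnK ha).
by rewrite /RL_dual => ->.
Qed.

(** Induction on the right exponent of a basis vector v_e: for f = [crossing e p 0], the image of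
    v_f is a unit times v_e plus terms with smaller right exponent, all of the same weight. *)
Lemma sigmaJK_surj p y :
  VJK_weight l y -> exists2 x, VJK_weight l x & sigmaJK p x = y.
Proof.
pose im z := exists2 x, VJK_weight l x & sigmaJK p x = z.
have im0 : im 0 by exists 0; [apply: in_span0 | rewrite linear0].
have imP a z z' : im z -> im z' -> im (a *: z + z').
  move=> [x xl <-] [x' xl' <-]; exists (a *: x + x'); last by rewrite linearP.
  exact: VJK_weightZD.
have imv e : wt e = l -> im (vJK e).
  have [k ek] : exists k, (e (strandR p) < k)%N by exists (e (strandR p)).+1.
  elim: k e ek => // k IH e ek el; pose f := crossing e p 0.
  have fL : f (strandL p) = e (strandR p) by rewrite crossingL addn0.
  have fl : wt f = l by rewrite wt_crossing.
  have imf : im (sigmaJK p (vJK f)).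
    exists (vJK f) => //; apply/VJK_weightP => g gl; rewrite cf_vJK.
    by case: eqP => // fg; rewrite -fg fl eqxx in gl.
  have uc : RL_dual (f (strandR p)) (f (strandL p)) 0 \is a GRing.unit.
    exact: (D_0_unit sL_unit RL_dual_00 RL_dual_rec0).
  move: imf; rewrite sigmaJK_vJK big_ord_recl /= addn0 subn0 crossingK //.
  set c := RL_dual _ _ _; set S := \sum_(i < _) _ => imS.
  have imSN : im (- S).
    rewrite -sumrN; apply: big_ind => // [z z' hz hz'|a _].
      by rewrite -[z]scale1r; apply: (imP).
    rewrite -scaleNr -[_ *: _]addr0; apply: (imP) => //; apply: IH.
      rewrite crossingR; apply: leq_trans (ek : (e (strandR p) <= k)%N).
      by rewrite -fL ltn_subrL (leq_ltn_trans _ (ltn_ord a)).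
    by rewrite wt_crossing.
  rewrite -[vJK e]scale1r -(mulVr uc) -/c -scalerA -[_ *: _]addr0; apply: (imP) => //.
  rewrite -[c *: _](addrK S) -[c *: _ + S]scale1r; exact: imP.
move/VJK_weightP => yl; rewrite [y]VJK_sumE.
have : all (fun e => wt e == l) (dom y).
  apply/allP => e; rewrite mem_dom; apply: contraNT => el; exact/eqP/yl.
elim: (dom y) => [|e r IH] /=; first by rewrite big_nil.
move=> /andP[/eqP el rl]; rewrite big_cons; apply: (imP); first exact: imv.
exact: IH.
Qed.

(** A preimage x of a kernel vector is in the kernel, since sigma_p (E x) = E (sigma_p x) = 0 and
    sigma_p is injective. *)
Lemma sigmaJK_WJK_surj p y :
  y \in WJK_pred l -> exists2 x, x \in WJK_pred l & sigmaJK p x = y.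
Proof.
move=> /WJK_predP[Ey yl].
have [x /VJK_weightP xl sx] := sigmaJK_surj p ((VJK_weightP l y).2 yl).
exists x => //; apply/WJK_predP; split=> // e.
have h := @sigma_coef_inj _ qL sL n sL_unit _ RL_dual_00 RL_dual_rec0 predT p.
apply: (h (Ecoef qL sL predT (cf x)) _ e isT) => f _.
by rewrite -sigmaJK_Ecoef sx.
Qed.

Definition sigmaW p (w : W) : W := MkWJK (sigmaJK_WJK p (valP w)).

Lemma sigmaW_linear p : linear (sigmaW p).
Proof.
move=> a w w'; apply: val_inj; rewrite linearP /=.
exact: linearP.
Qed.

HB.instance Definition _ p :=
  GRing.isLinear.Build laurent W W *:%R (sigmaW p) (sigmaW_linear p).

Lemma sigmaW_surj p (w : W) : exists w', sigmaW p w' = w.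
Proof.
have [x xW sx] := sigmaJK_WJK_surj p (valP w).
by exists (MkWJK xW); apply: val_inj.
Qed.

Definition sigmaW_inv p (w : W) : W := sval (cid (sigmaW_surj p w)).

Lemma sigmaW_invK p : cancel (sigmaW_inv p) (sigmaW p).
Proof. by move=> w; rewrite /sigmaW_inv; case: cid. Qed.

Lemma sigmaWK p : cancel (sigmaW p) (sigmaW_inv p).
Proof.
move=> w; apply: val_inj; apply: (@sigmaJK_inj p).
exact: (congr1 val (sigmaW_invK p (sigmaW p w))).
Qed.

HB.instance Definition _ p :=
  GRing.isLinear.Build laurent W W *:%R (sigmaW_inv p)
    (can2_linear (sigmaWK p) (sigmaW_invK p)).

Definition letterW (x : 'I_n.-1 * bool) : {linear W -> W} :=
  if x.2 then GRing.Linear.clone _ _ _ _ (sigmaW_inv x.1) _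
  else GRing.Linear.clone _ _ _ _ (sigmaW x.1) _.

Fixpoint wordW (u : braid_word n) : {linear W -> W} :=
  if u is x :: u' then (letterW x \o wordW u')%FUN else idfun.

Lemma wordW_cat u v : wordW (u ++ v) =1 wordW u \o wordW v.
Proof. by elim: u => //= x u IH w; rewrite /= IH. Qed.

Lemma wordW_eq u v : braid_eq u v -> wordW u =1 wordW v.
Proof.
elim=> {u v} [u|u v _ IH|u v w _ IH1 _ IH2|u u' v v' _ IH1 _ IH2|i b|i j ij|i j ij] w0.
- by [].
- by rewrite IH.
- by rewrite IH1 IH2.
- by rewrite !wordW_cat /= IH2 IH1.
- by case: b; rewrite /= ?sigmaWK ?sigmaW_invK.
- apply: val_inj; apply: cf_inj => e; rewrite /= !cf_sigmaJKE.
  by rewrite sigma_coef_far.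
apply: val_inj; apply: cf_inj => e; rewrite /= !cf_sigmaJKE.
by rewrite (sigma_coef_near qL_unit sL_unit RL_dual_00 RL_dual_gt RL_dual_rec0
  RL_dual_rec).
Qed.

(** Evaluated on the chosen representative word; [wordW_eq] makes the choice immaterial. *)
Definition rhoW (g : braid n) : {linear W -> W} := wordW (repr g).

Lemma rhoW_pi u : rhoW (\pi_(braid n) u) =1 wordW u.
Proof. by apply: wordW_eq; apply: braid_reprK. Qed.

Lemma rhoW_rep : is_rep rhoW.
Proof.
split; first exact: rhoW_pi.
by move=> g h w; rewrite [LHS]rhoW_pi wordW_cat.
Qed.

Lemma rhoW_artin p (w : W) : val (rhoW (artin p) w) = sigmaJK p (val w).
Proof. by rewrite rhoW_pi. Qed.

End BraidAction.

(** * Kernel basis and base change *)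

Section KernelIndex.

Definition pad m r (t : m.-tuple 'I_r) : {ffun 'I_m.+1 -> nat} :=
  [ffun k => if unlift ord_max k is Some k' then nat_of_ord (tnth t k') else 0%N].

Lemma pad_last m r (t : m.-tuple 'I_r) : pad t ord_max = 0%N.
Proof. by rewrite ffunE unlift_none. Qed.

Lemma pad_lift m r (t : m.-tuple 'I_r) k : pad t (fintype.lift ord_max k) = tnth t k.
Proof. by rewrite ffunE liftK. Qed.

Lemma wt_pad m r (t : m.-tuple 'I_r) : wt (pad t) = (\sum_(i <- t) i)%N.
Proof.
rewrite /wt (bigD1_ord ord_max) //= pad_last add0n big_tuple.
by apply: eq_bigr => k _; rewrite pad_lift.
Qed.

Lemma kernel_index m l : exists dex : 'I_('C(m.+2 + l - 2, l)) -> {ffun 'I_m.+2 -> nat},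
  [/\ injective dex, forall i, dex i ord_max = 0%N, forall i, wt (dex i) = l
    & forall e : {ffun 'I_m.+2 -> nat},
        e ord_max = 0%N -> wt e = l -> exists i, dex i = e].
Proof.
pose D := [set t : m.+1.-tuple 'I_l.+1 | \sum_(i <- t) i == l]%N.
(* The tuples of m + 1 naturals with sum l number 'C(m + l, m), which equals 'C(m + l, l) by
   symmetry. *)
have cD : ('C(m.+2 + l - 2, l) = #|D|)%N.
  rewrite card_ord_partitions !addSn !subSS subn0 -[in RHS]bin_sub ?leq_addr //.
  by rewrite addKn.
exists (fun i => pad (enum_val (cast_ord cD i))); split.
- move=> i j ij; apply: (@cast_ord_inj _ _ cD); apply: enum_val_inj.
  apply: eq_from_tnth => k; apply: val_inj => /=.
  by rewrite -!pad_lift ij.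
- by move=> i; apply: pad_last.
- move=> i; rewrite wt_pad; apply/eqP.
  by have := enum_valP (cast_ord cD i); rewrite inE.
move=> e emax el.
have ek k : (e k < l.+1)%N by rewrite ltnS -el leq_wt.
pose t : m.+1.-tuple 'I_l.+1 :=
  [tuple Ordinal (ek (fintype.lift ord_max k)) | k < m.+1].
have te : pad t = e.
  apply/ffunP => k; case: (unliftP ord_max k) => [k' ->|->].
    by rewrite pad_lift tnth_mktuple.
  by rewrite pad_last emax.
have tD : t \in D by rewrite inE -wt_pad te el.
exists (cast_ord (esym cD) (enum_rank_in tD t)).
by rewrite cast_ordKV enum_rankK_in.
Qed.

End KernelIndex.

(** * Pure tensors in a base change *)

Section PureTensors.
Variables (A : comNzRingType) (K : fieldType) (theta : {rmorphism A -> K}).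
Variable M : lmodType A.
Local Notation pure := (pure_tensor theta (M := M)).
Implicit Types v w : M.

Lemma pure_tensorZ w c : pure w c = c *: pure w 1.
Proof.
have := @modquot_pi_linear _ _ (@bc_rel _ _ theta M) c << w >> 0.
have -> : \pi_(modquot (@bc_rel _ _ theta M)) 0 = 0 by [].
by rewrite !addr0 freegZU mulr1.
Qed.

Lemma pure_tensorD v w : pure (v + w) 1 = pure v 1 + pure w 1.
Proof.
rewrite [RHS](modquot_addE (@bc_rel _ _ theta M) << v >> << w >>).
apply/modquotP; rewrite opprD addrA.
apply: in_span_gen; exact: BcAdd.
Qed.

Lemma pure_tensor_scale a w : pure (a *: w) 1 = theta a *: pure w 1.
Proof.
apply: etrans (pure_tensorZ w (theta a)).
apply/modquotP.
apply: in_span_gen; exact: BcScale.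
Qed.

Lemma pure_tensor_sum (I : finType) (a : I -> A) (w : I -> M) :
  pure (\sum_i a i *: w i) 1 = \sum_i theta (a i) *: pure (w i) 1.
Proof.
rewrite (big_morph (fun v => pure v 1) pure_tensorD (id1 := 0)).
  by apply: eq_bigr => i _; rewrite pure_tensor_scale.
by rewrite -[in LHS](scale0r 0) pure_tensor_scale rmorph0 scale0r.
Qed.

Lemma base_change_ind (P : base_change theta M -> Prop) :
  P 0 -> (forall x y, P x -> P y -> P (x + y)) ->
  (forall w c, P (pure w c)) -> forall x, P x.
Proof.
move=> P0 PD Pw; elim/quotW => x; rewrite -[x]freeg_sumE.
elim: (dom x) => [|z r IH]; first by rewrite big_nil.
rewrite big_cons -[<< _ *g _ >>]scale1r modquot_pi_linear scale1r.
by apply: PD => //; apply: Pw.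
Qed.

End PureTensors.

(** * A Laurent basis of the kernel, its matrices and their specialization *)

Section KernelBasis.
Variables (n l d : nat) (dex : 'I_d -> {ffun 'I_n.+1 -> nat}).
Hypotheses (dex_inj : injective dex) (dex_last : forall i, dex i ord_max = 0%N).
Hypotheses (dex_wt : forall i, wt (dex i) = l).
Hypothesis dex_surj :
  forall e : {ffun 'I_n.+1 -> nat},
    e ord_max = 0%N -> wt e = l -> exists i, dex i = e.
Local Notation W := (WJK n.+1 l).

Definition ker_coef i := ker_ext qL sL (fun e => (e == dex i)%:R).

Lemma ker_coef_wt i e : wt e != l -> ker_coef i e = 0.
Proof.
apply: ker_ext_wt => f fl; case: eqP => // fi.
by rewrite fi dex_wt eqxx in fl.
Qed.

(** A vector of the free module needs finite support: weight l bounds every entry by l, so the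
    exponents with values in ['I_l.+1] suffice. *)
Definition ker_vec i : VJK n.+1 :=
  \sum_(t : {ffun 'I_n.+1 -> 'I_l.+1}) ker_coef i (exps t) *: vJK (exps t).

Lemma cf_ker_vec i e : cf (ker_vec i) e = ker_coef i e.
Proof.
rewrite cf_sum -[RHS](sum_exps _ (ltnSn l) (@ker_coef_wt i)).
by apply: eq_bigr => t _; rewrite cfZ cf_vJK.
Qed.

Lemma ker_vec_WJK i : ker_vec i \in WJK_pred l.
Proof.
apply/WJK_predP; split=> e; last by rewrite cf_ker_vec; apply: ker_coef_wt.
rewrite (_ : cf _ = ker_coef i); first exact: Ecoef_ker_ext.
by apply: funext => f; apply: cf_ker_vec.
Qed.

Definition ker_basis i : W := MkWJK (ker_vec_WJK i).

(** The coefficients at e_n = 0 determine a kernel vector and are indicators on [ker_basis], so they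
    are the coordinates in that basis. *)
Definition coordW (w : W) : 'cV[laurent]_d := \col_i cf (val w) (dex i).

Lemma coordW_linear : linear coordW.
Proof.
move=> a v w; apply/colP => i; rewrite !mxE -cfP; congr (cf _ _).
Qed.

HB.instance Definition _ :=
  GRing.isLinear.Build laurent W 'cV[laurent]_d *:%R coordW coordW_linear.

Lemma coordW_basis j : coordW (ker_basis j) = delta_mx j 0.
Proof.
apply/colP => i; rewrite !mxE cf_ker_vec /ker_coef ker_ext0 // andbT.
by rewrite (inj_eq dex_inj).
Qed.

Lemma coordW_inj : injective coordW.
Proof.
move=> v w vw; apply: val_inj; apply: cf_inj.
apply: ker_uniq; try exact: cf_WJK_E.
move=> e emax; have [|el] := eqVneq (wt e) l; last by rewrite !cf_WJK_wt.
by case/(dex_surj emax) => i <-; move/colP/(_ i): vw; rewrite !mxE.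
Qed.

Lemma coordWK w : w = \sum_i coordW w i 0 *: ker_basis i.
Proof.
apply: coordW_inj; rewrite linear_sum; apply/colP => i; rewrite summxE.
under eq_bigr do rewrite linearZ /= coordW_basis !mxE andbT.
rewrite (bigD1 i) //= eqxx mulr1 big1 ?addr0 ?mxE // => j /negPf ji.
by rewrite eq_sym ji mulr0.
Qed.

Definition rhoL (g : braid n.+1) : 'M[laurent]_d :=
  \matrix_(i, j) coordW (rhoW l g (ker_basis j)) i 0.

Lemma coordW_rho g w : coordW (rhoW l g w) = rhoL g *m coordW w.
Proof.
rewrite [w in LHS]coordWK linear_sum linear_sum; apply/colP => i.
rewrite summxE mxE; apply: eq_bigr => j _.
by rewrite linearZ linearZ [rhoL g _ _]mxE [LHS]mxE mulrC.
Qed.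

Lemma rhoLE M g : (forall j, coordW (rhoW l g (ker_basis j)) = M *m delta_mx j 0) ->
  rhoL g = M.
Proof. by move=> h; apply/matrixP => i j; rewrite mxE h -colE mxE. Qed.

Lemma rhoL1 : rhoL 1%g = 1%:M.
Proof.
by apply: rhoLE => j; rewrite (rhoW_rep n.+1 l).1 coordW_basis mul1mx.
Qed.

Lemma rhoLM g h : rhoL (g * h)%g = rhoL g *m rhoL h.
Proof.
apply: rhoLE => j; rewrite (rhoW_rep n.+1 l).2 /= !coordW_rho coordW_basis.
exact: mulmxA.
Qed.

Section Specialize.
Variables (K : fieldType) (theta : {rmorphism laurent -> K}).

(** The inverse matrix, that of g^-1, already has Laurent entries and specializes along. *)
Lemma rhoK_unit g : map_mx theta (rhoL g) \in unitmx.
Proof.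
have : map_mx theta (rhoL g) *m map_mx theta (rhoL g^-1%g) = 1%:M.
  by rewrite -map_mxM -rhoLM mulgV rhoL1 map_mx1.
by case/mulmx1_unit.
Qed.

Definition rhoK g : GL K d := MkGL (rhoK_unit g).

Lemma rhoKM : {morph rhoK : g h / (g * h)%g}.
Proof. by move=> g h; apply: val_inj; rewrite /= rhoLM map_mxM. Qed.

HB.instance Definition _ := isMultiplicative.Build (braid n.+1) (GL K d) rhoK rhoKM.

Definition coordK (w : W) : 'cV[K]_d := map_mx theta (coordW w).

Lemma coordK_rho g w : coordK (rhoW l g w) = rhoK g *m coordK w.
Proof. by rewrite /coordK coordW_rho map_mxM. Qed.

Let lift_coord : {freeg W / K} -> 'cV[K]_d := fglift coordK.

Definition bc_coord (x : base_change theta W) : 'cV[K]_d := lift_coord (repr x).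

(** This makes [bc_coord] independent of the representative in the quotient. *)
Lemma lift_coord_rel x : bc_rel theta x -> lift_coord x = 0.
Proof.
rewrite /lift_coord; case=> [v w|a w]; rewrite !linearB /= !liftU !scale1r.
  by rewrite /coordK linearD map_mxD addrAC addrK subrr.
by rewrite /coordK linearZ map_mxZ subrr.
Qed.

Lemma bc_coord_pi x : bc_coord (\pi_(modquot (@bc_rel _ _ theta W)) x) = lift_coord x.
Proof.
apply/eqP; rewrite -subr_eq0 /bc_coord /lift_coord -linearB /=.
have [t [Pt ->]] := modquot_repr (@bc_rel _ _ theta W) x.
rewrite linear_sum big_seq big1 // => p /Pt Pp; rewrite linearZ /=.
by rewrite [fglift _ _](lift_coord_rel Pp) scaler0.
Qed.

Lemma bc_coord_linear : linear bc_coord.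
Proof.
move=> c; elim/quotW=> x; elim/quotW=> y.
by rewrite -modquot_pi_linear !bc_coord_pi /lift_coord linearP.
Qed.

HB.instance Definition _ := GRing.isLinear.Build K _ _ *:%R bc_coord bc_coord_linear.

Lemma bc_coordE w c : bc_coord (pure_tensor theta w c) = c *: coordK w.
Proof. by rewrite bc_coord_pi /lift_coord liftU. Qed.

Definition bc_vec (v : 'cV[K]_d) : base_change theta W :=
  \sum_i v i 0 *: pure_tensor theta (ker_basis i) 1.

Lemma bc_coordK : cancel bc_coord bc_vec.
Proof.
have vecP a u v : bc_vec (a *: u + v) = a *: bc_vec u + bc_vec v.
  rewrite scaler_sumr -big_split; apply: eq_bigr => i _ /=.
  by rewrite !mxE scalerDl scalerA.
apply: base_change_ind => [|x y IHx IHy|w c].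
- by rewrite linear0 /bc_vec big1 // => i _; rewrite mxE scale0r.
- by rewrite linearD /= -[bc_coord x]scale1r vecP IHx IHy scale1r.
rewrite bc_coordE -[_ *: _]addr0 vecP [bc_vec 0]big1 ?addr0; last first.
  by move=> i _; rewrite mxE scale0r.
rewrite pure_tensorZ; congr (_ *: _); rewrite [in RHS](coordWK w) /bc_vec.
rewrite pure_tensor_sum; apply: eq_bigr => i _.
by rewrite mxE.
Qed.

Lemma bc_vecK : cancel bc_vec bc_coord.
Proof.
move=> v; rewrite linear_sum; apply/colP => i; rewrite summxE.
under eq_bigr do rewrite linearZ /= bc_coordE scale1r /coordK coordW_basis !mxE andbT.
rewrite (bigD1 i) //= eqxx rmorph1 mulr1 big1 ?addr0 // => j /negPf ji.
by rewrite eq_sym ji rmorph0 mulr0.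
Qed.

Lemma bc_coord_bij : bijective bc_coord.
Proof. exact: Bijective bc_coordK bc_vecK. Qed.

Lemma bc_coord_rho g x :
  bc_coord (bc_map (rhoW l g) x) = rhoK g *m bc_coord x.
Proof.
move: x; apply: base_change_ind => [|x y IHx IHy|w c].
- by rewrite !linear0.
- by rewrite !linearD /= IHx IHy.
by rewrite bc_mapE !bc_coordE coordK_rho -scalemxAr.
Qed.

End Specialize.
End KernelBasis.

(** * The root of unity *)

Section QuantumBinomialSpecialization.

(** A division-free form of the quantum binomial, which any specialization respects. The powers of
    {1} in numerator and denominator of the factorial quotient both have exponent a + j and
    cancel. *)
Lemma qbinom_braces (F : fieldType) (q : F) a j :
  (forall x, (x < a + j)%N -> qbrace q x.+1 != 0) ->
  qbinom q (a + j) j *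
    (\prod_(x < a) qbrace q x.+1 * \prod_(x < j) qbrace q x.+1) =
  \prod_(x < a + j) qbrace q x.+1.
Proof.
move=> h.
have b0 : qbrace q 1 ^+ (a + j) != 0.
  (* For a + j = 0 the hypothesis says nothing about {1}, but only its zeroth power occurs. *)
  case: (posnP (a + j)) => [->|aj]; first by rewrite expr0 oner_neq0.
  by rewrite expf_neq0 // h.
have fE m : qfact q m = \prod_(x < m) qbrace q x.+1 / qbrace q 1 ^+ m.
  by rewrite /qfact big_add1 big_mkord big_split /= prodr_const card_ord exprVn.
have p0 m : (m <= a + j)%N -> \prod_(x < m) qbrace q x.+1 != 0.
  move=> mj; apply/prodf_neq0 => x _; apply: h.
  exact: leq_trans (ltn_ord x) mj.
rewrite /qbinom addnK !fE; move: b0 (p0 _ (leq_addr j a)) (p0 _ (leq_addl a j)).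
rewrite exprD mulf_eq0 negb_or => /andP[ba bj] pa pj; field.
by rewrite ba bj pa pj.
Qed.

Definition braceL x : laurent := qL ^+ x - qL ^- x.

Lemma laurent_frac_brace x : laurent_frac (braceL x) = qbrace qF x.
Proof. by rewrite rmorphB (rmorphXn _ x qL) rmorphVX ?qL_unit. Qed.

Lemma qbinomL_braces a j :
  qbinomL a j * (\prod_(x < a) braceL x.+1 * \prod_(x < j) braceL x.+1) =
  \prod_(x < a + j) braceL x.+1.
Proof.
apply: laurent_frac_inj; rewrite !(rmorphM, rmorph_prod).
under eq_bigr do rewrite laurent_frac_brace.
under [X in _ * (_ * X)]eq_bigr do rewrite laurent_frac_brace.
under [RHS]eq_bigr do rewrite laurent_frac_brace.
by apply: qbinom_braces => x _; apply: qbrace_neq0 qF_neq0 qF_pow_neq1 _.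
Qed.

Section Field.
Variables (K : fieldType) (theta : {rmorphism laurent -> K}) (q : K).
Hypothesis theta_q : theta qL = q.

Lemma spec_brace x : theta (braceL x) = qbrace q x.
Proof. by rewrite rmorphB rmorphXn rmorphVX ?qL_unit // theta_q. Qed.

Lemma spec_qbinom a j : (forall x, (x < a + j)%N -> qbrace q x.+1 != 0) ->
  theta (qbinomL a j) = qbinom q (a + j) j.
Proof.
move=> h; have := congr1 theta (qbinomL_braces a j).
rewrite rmorphM rmorphM !rmorph_prod.
under eq_bigr do rewrite spec_brace.
under [X in _ * (_ * X)]eq_bigr do rewrite spec_brace.
under [RHS]eq_bigr do rewrite spec_brace.
rewrite -(qbinom_braces h); apply: mulIf.
by rewrite mulf_neq0 //; apply/prodf_neq0 => x _; apply: h;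
   apply: leq_trans (ltn_ord x) _; rewrite ?leq_addr ?leq_addl.
Qed.

Variable s : K.
Hypothesis theta_s : theta sL = s.

Lemma spec_K_eigen m : theta (K_eigen qL sL m) = K_eigen q s m.
Proof. by rewrite rmorphM rmorphVX ?qL_unit // theta_q theta_s. Qed.

Lemma spec_Ecoef n (x : {ffun 'I_n -> nat} -> laurent) e :
  theta (Ecoef qL sL predT x e) = Ecoef q s predT (theta \o x) e.
Proof.
rewrite rmorph_sum; apply: eq_bigr => i _; rewrite rmorphM rmorph_prod.
by congr (_ * _); apply: eq_bigr => k _; apply: spec_K_eigen.
Qed.

Definition R_spec : nat -> nat -> nat -> K :=
  R_dual q s (fun a j => qbinom q (a + j) j) (fun m j => qbrace q (m + j + 1)).

Hypothesis s_q : s * q = -1.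
Variable r : nat.
Hypothesis brace_neq0 : forall x, (x.+1 < r)%N -> qbrace q x.+1 != 0.

Lemma spec_R_dual y z a : (y < r)%N -> theta (RL_dual y z a) = R_spec y z a.
Proof.
move=> yr; rewrite /RL_dual /R_spec /R_dual; case: ifP => ay; last exact: rmorph0.
have q0 : q != 0.
  by apply: contra_eq_neq s_q => ->; rewrite mulr0 eq_sym oppr_eq0 oner_neq0.
have sE : s = - q^-1 by rewrite -[s](mulfK q0) s_q mulN1r.
rewrite /R_coef !rmorphM !rmorphXn rmorph_prod rmorphVX ?sL_unit //.
(* The upper entry of the binomial is a + (y - a) = y < r, so only the braces {1}, ..., {y} must be
   nonzero. *)
rewrite theta_q theta_s spec_qbinom; last first.
  by move=> x; rewrite subnKC // => xy; apply: brace_neq0; apply: leq_ltn_trans xy yr.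
(* With s = -q^-1 the generic factor s q^-(m+j) - s^-1 q^(m+j) becomes {m+j+1}. *)
congr (_ * _); apply: eq_bigr => m _; rewrite rmorphB !rmorphM rmorphXn.
rewrite rmorphVX ?qL_unit // rmorphV ?sL_unit // theta_q theta_s sE /qbrace.
rewrite addn1 exprS; field.
by rewrite q0 expf_neq0 // oppr_eq0 oner_neq0.
Qed.

Lemma spec_sigma_coef n l p (x : {ffun 'I_n -> nat} -> laurent) e :
  (l < r)%N -> (forall e, wt e != l -> x e = 0) ->
  theta (sigma_coef RL_dual p x e) = sigma_coef R_spec p (theta \o x) e.
Proof.
move=> lr xl; rewrite rmorph_sum; apply: eq_bigr => a _; rewrite rmorphM /=.
have [el|el] := eqVneq (wt e) l.
  by rewrite spec_R_dual // (leq_ltn_trans (leq_wt e _)) ?el.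
by rewrite xl ?rmorph0 ?mulr0 // wt_crossing // -ltnS.
Qed.

End Field.
End QuantumBinomialSpecialization.

(** * Powers and braces of q = e^(pi i / r) *)

Section RootFacts.
Variables (R : realType) (r : nat).
Hypothesis r_gt1 : (1 < r)%N.
Local Notation q := (q_root R r).

Lemma q_rootX m : q ^+ m =
  (cos (m%:R * (pi / r%:R)) +i* sin (m%:R * (pi / r%:R)))%C.
Proof.
elim: m => [|m IH]; first by rewrite expr0 mul0r cos0 sin0.
have -> : m.+1%:R * (pi / r%:R) = m%:R * (pi / r%:R) + pi / r%:R :> R.
  by rewrite -natr1 mulrDl mul1r.
rewrite exprS IH mulrC cosD sinD.
by apply/eqP; rewrite eq_complex /= eqxx /= addrC eqxx.
Qed.

Lemma q_root_half : q ^+ r = -1.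
Proof.
have r0 : r%:R != 0 :> R by rewrite pnatr_eq0 -lt0n ltnW.
rewrite q_rootX mulrC divfK // cospi sinpi; apply/eqP.
by rewrite eq_complex /= oppr0 !eqxx.
Qed.

Lemma s_root_q : s_root R r * q = -1.
Proof. by rewrite -exprSr subn1 prednK ?q_root_half // ltnW. Qed.

(** A vanishing brace would give q^(2(x+1)) = 1. The angle th = (x+1) pi / r lies strictly between 0
    and pi, so sin th > 0; the imaginary part then forces cos th = 0, and the real part reads 1 = -
    sin^2 th. *)
Lemma q_root_brace x : (x.+1 < r)%N -> qbrace q x.+1 != 0.
Proof.
move=> xr; rewrite subr_eq0; apply/eqP => qq.
have q0 : q ^+ x.+1 != 0 by rewrite expf_neq0 // q_root_neq0.
have : q ^+ x.+1 * q ^+ x.+1 = 1 by rewrite {1}qq mulVf.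
rewrite q_rootX; set th := (_ * (pi / _) : R) => -[h1 h2].
have r0 : 0 < r%:R :> R by rewrite ltr0n ltnW.
have s0 : 0 < sin th.
  apply: sin_gt0_pi; rewrite mulr_gt0 ?ltr0n ?divr_gt0 ?pi_gt0 //=.
  by rewrite /th mulrCA gtr_pMr ?pi_gt0 // ltr_pdivrMr // mul1r ltr_nat.
have /eqP : cos th * sin th = 0.
  apply: (@mulIf _ 2); rewrite ?pnatr_eq0 // mul0r mulr_natr mulr2n.
  by rewrite -{2}[cos th * _]mulrC.
rewrite mulf_eq0 (gt_eqF s0) orbF => /eqP c0; move: h1; rewrite c0 mul0r sub0r => h1.
have : 0 < (1 : R) by [].
by rewrite -h1 oppr_gt0 ltNge mulr_ge0 // ltW.
Qed.

End RootFacts.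

(** * E and sigma_p at the root of unity, on coefficient functions *)

Section RootCoefficients.
Variables (R : realType) (r n l : nat).
Hypothesis l_lt_r : (l < r)%N.
Local Notation expo := {ffun 'I_n -> nat}.
Local Notation q := (q_root R r).
Local Notation s := (s_root R r).
Local Notation V := (Vroot R r n).
Implicit Types (X Y : expo -> R[i]) (w : V) (e f : expo) (p : 'I_n.-1).

Definition vec_of X : V := [ffun t => X (exps t)].

(** Extension by zero from the truncated exponents to all of N^n. *)
Definition coef_of w : expo -> R[i] := fun e => \sum_t w t * (exps t == e)%:R.

Lemma urootE e (t : {ffun 'I_n -> 'I_r}) : uroot R r e t = (exps t == e)%:R.
Proof.
rewrite ffunE; congr (nat_of_bool _)%:R; apply/forallP/eqP => [h|<- k].
  by apply/ffunP => k; rewrite ffunE; apply/eqP.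
by rewrite ffunE.
Qed.

Lemma coef_ofK : cancel coef_of vec_of.
Proof.
move=> w; apply/ffunP => t; rewrite ffunE /coef_of (bigD1 t) //= eqxx mulr1.
rewrite big1 ?addr0 // => t' tt'.
by rewrite (inj_eq (@exps_inj _ r)) (negPf tt') mulr0.
Qed.

Lemma vec_of_inj X Y :
  (forall e, wt e != l -> X e = 0) -> (forall e, wt e != l -> Y e = 0) ->
  vec_of X = vec_of Y -> X =1 Y.
Proof.
move=> Xl Yl XY e; have [el|el] := eqVneq (wt e) l; last by rewrite Xl ?Yl.
have [t <-] := exps_surj l_lt_r el.
by have := congr1 (fun w : V => w t) XY; rewrite !ffunE.
Qed.

Lemma vec_of_weightP X :
  (forall e, wt e != l -> X e = 0) -> vec_of X \in Vroot_weight R r n l.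
Proof.
move=> Xl; have -> : vec_of X =
    \sum_(t : {ffun 'I_n -> 'I_r}) X (exps t) *: uroot R r (exps t).
  apply/ffunP => t; rewrite sum_ffunE ffunE -(sum_exps _ l_lt_r Xl).
  by apply: eq_bigr => u _; rewrite ffunE urootE eq_sym.
apply: rpred_sum => t _; have [tl|tl] := eqVneq (wt (exps t)) l; last first.
  by rewrite Xl // scale0r mem0v.
apply/rpredZ/memv_span/map_f; rewrite mem_filter mem_enum andbT -tl.
by apply/eqP/eq_bigr => k _; rewrite ffunE.
Qed.

Lemma coef_of_weight w : w \in Vroot_weight R r n l ->
  forall e, wt e != l -> coef_of w e = 0.
Proof.
move=> wV e el; rewrite /coef_of big1 // => t _.
case: eqP => [te|]; last by rewrite mulr0.
rewrite mulr1 (@coord_span _ _ _ (in_tuple _) _ wV) sum_ffunE big1 // => i _.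
rewrite ffunE /=; case/mapP: (mem_nth 0 (ltn_ord i)) => u.
rewrite mem_filter => /andP[/eqP ul _] ->.
rewrite urootE te; case: eqP => [eu|]; last by rewrite scaler0.
by case/eqP: el; rewrite eu -ul; apply: eq_bigr => k _; rewrite ffunE.
Qed.

(** Raising may leave the truncated range, but then an entry equals [r] and the weight exceeds l,
    where [X] vanishes. *)
Lemma Eroot_vec X : (forall e, wt e != l -> X e = 0) ->
  Eroot R r n (vec_of X) = vec_of (Ecoef q s predT X).
Proof.
move=> Xl; rewrite lfunE /=; apply/ffunP => t; rewrite /linear_ext sum_ffunE ffunE.
transitivity (\sum_(u : {ffun 'I_n -> 'I_r}) X (exps u) *
    Ecoef q s predT (fun g => (exps u == g)%:R) (exps t)).
  apply: eq_bigr => u _; rewrite !ffunE -E_row_col /E_basis sum_ffunE.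
  by congr (_ * _); apply: eq_bigr => i _; rewrite ffunE urootE eq_sym.
rewrite /Ecoef; under eq_bigr do rewrite mulr_sumr.
rewrite exchange_big /=; apply: eq_bigr => i _.
rewrite -(sum_exps _ l_lt_r Xl) mulr_sumr; apply: eq_bigr => u _.
by rewrite mulrCA.
Qed.

Lemma sigma_root_vec p X : (forall e, wt e != l -> X e = 0) ->
  sigma_root R r p (vec_of X) = vec_of (sigma_coef (R_spec q s) p X).
Proof.
move=> Xl; rewrite lfunE /=; apply/ffunP => t; rewrite /linear_ext sum_ffunE ffunE.
pose C := R_coef q s (fun a j => qbinom q (a + j) j)
  (fun m j => qbrace q (m + j + 1)).
transitivity (\sum_(u : {ffun 'I_n -> 'I_r}) X (exps u) *
    sigma_coef (R_spec q s) p (fun g => (exps u == g)%:R) (exps t)).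
  apply: eq_bigr => u _; rewrite !ffunE.
  have [ul|ul] := eqVneq (wt (exps u)) l; last by rewrite Xl ?mul0r ?scale0r.
  rewrite /sigma_basis sum_ffunE.
  (* As i + j <= l < r, the bound min(i, r - j - 1) is the generic bound i. *)
  rewrite (minn_idPl _); last first.
    have : (exps u (strandL p) + exps u (strandR p) <= l)%N.
      rewrite -ul /wt (bigD1 (strandL p)) //= (bigD1 (strandR p)) ?strandR_neqL //=.
      by rewrite addnA leq_addr.
    by move=> h; rewrite -subnDA leq_subRL; lia.
  congr (_ * _).
  under eq_bigr do rewrite ffunE urootE eq_sym.
  rewrite (sigma_row_col C); apply: eq_bigr => a _.
  by rewrite /R_spec /R_dual -ltnS ltn_ord.
rewrite /sigma_coef; under eq_bigr do rewrite mulr_sumr.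
rewrite exchange_big /=; apply: eq_bigr => a _.
rewrite -(sum_exps _ l_lt_r Xl) mulr_sumr; apply: eq_bigr => u _.
by rewrite mulrCA.
Qed.

End RootCoefficients.

(** * Comparison of the two kernels through common matrices *)

Section Assembly.
Variables (R : realType) (r n l d : nat) (dex : 'I_d -> {ffun 'I_n.+1 -> nat}).
Hypotheses (r_gt1 : (1 < r)%N) (l_lt_r : (l < r)%N).
Hypotheses (dex_inj : injective dex) (dex_last : forall i, dex i ord_max = 0%N).
Hypotheses (dex_wt : forall i, wt (dex i) = l).
Hypothesis dex_surj : forall e : {ffun 'I_n.+1 -> nat},
  e ord_max = 0%N -> wt e = l -> exists i, dex i = e.
Local Notation q := (q_root R r).
Local Notation s := (s_root R r).
Local Notation theta := (spec_root R r).
Implicit Type x : 'cV[R[i]]_d.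

Let theta_q : theta qL = q. Proof. exact: spec_q. Qed.
Let theta_s : theta sL = s. Proof. exact: spec_s. Qed.

Definition ker_comb x (e : {ffun 'I_n.+1 -> nat}) : R[i] :=
  \sum_i x i 0 * theta (ker_coef dex i e).

Lemma ker_comb_wt x e : wt e != l -> ker_comb x e = 0.
Proof.
move=> el; rewrite /ker_comb big1 // => i _.
by rewrite (ker_coef_wt dex_wt) ?rmorph0 ?mulr0.
Qed.

Lemma ker_comb_dex x i : ker_comb x (dex i) = x i 0.
Proof.
rewrite /ker_comb (bigD1 i) // /ker_coef ker_ext0 // eqxx (rmorph1 theta) mulr1.
rewrite big1 => [|j ji]; first exact: addr0.
rewrite ker_ext0 // (inj_eq dex_inj).
by rewrite eq_sym (negPf ji) rmorph0 mulr0.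
Qed.

Lemma Ecoef_ker_comb x e : Ecoef q s predT (ker_comb x) e = 0.
Proof.
transitivity (\sum_i x i 0 * theta (Ecoef qL sL predT (ker_coef dex i) e)).
  under [RHS]eq_bigr do rewrite (spec_Ecoef theta_q theta_s) mulr_sumr.
  rewrite exchange_big; apply: eq_bigr => j _ /=; rewrite mulr_sumr.
  by apply: eq_bigr => i _; rewrite mulrCA.
by rewrite big1 // => i _; rewrite Ecoef_ker_ext rmorph0 mulr0.
Qed.

Definition root_vec x : Vroot R r n.+1 := vec_of r (ker_comb x).

Lemma root_vec_linear : linear root_vec.
Proof.
move=> a x y; apply/ffunP => t; rewrite !ffunE /ker_comb scaler_sumr -big_split.
by apply: eq_bigr => i _ /=; rewrite !mxE mulrDl -mulrA.
Qed.

HB.instance Definition _ :=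
  GRing.isLinear.Build R[i] _ _ *:%R root_vec root_vec_linear.

Lemma root_vec_inj : injective root_vec.
Proof.
move=> x y xy; apply/colP => i; rewrite -!ker_comb_dex.
exact: (vec_of_inj l_lt_r (ker_comb_wt x) (ker_comb_wt y) xy).
Qed.

(** A kernel vector is recovered from its coefficients at the [dex i]: [ker_uniq], now over the
    complex numbers, identifies it with the corresponding combination of specialized basis
    functions. *)
Lemma root_vec_Wroot w :
  w \in Wroot R r n.+1 l <-> exists x, w = root_vec x.
Proof.
split=> [|[x ->]].
  rewrite memv_cap memv_ker => /andP[/eqP Ew /coef_of_weight wl].
  exists (\col_i coef_of w (dex i)); rewrite -[LHS]coef_ofK.
  apply/ffunP => t; rewrite !ffunE; move: (exps t).
  apply: (@ker_uniq _ q s); first last.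
  - move=> e emax; have [el|el] := eqVneq (wt e) l; last by rewrite wl ?ker_comb_wt.
    by have [i <-] := dex_surj emax el; rewrite ker_comb_dex mxE.
  - exact: Ecoef_ker_comb.
  (* The kernel equation of [Eroot] is given at truncated exponents only. If wt e + 1 = l, then wt e
     < r and [e] is one of them; otherwise every coefficient involved has weight other than l. *)
  move=> e; have [el|el] := eqVneq (wt e).+1 l; last first.
    by rewrite /Ecoef big1 // => i _; rewrite wl ?mulr0 // wt_raise.
  have er : (wt e < r)%N by rewrite ltnW // el.
  have [t' <-] := exps_surj er erefl.
  have := Eroot_vec l_lt_r wl; rewrite coef_ofK Ew => /ffunP/(_ t').
  by rewrite !ffunE.
rewrite memv_cap memv_ker vec_of_weightP ?andbT //; last exact: ker_comb_wt.
rewrite (Eroot_vec l_lt_r (ker_comb_wt x)); apply/eqP/ffunP => t.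
by rewrite !ffunE Ecoef_ker_comb.
Qed.

Lemma dim_Wroot : \dim (Wroot R r n.+1 l) = d.
Proof.
have -> : Wroot R r n.+1 l = limg (linfun root_vec).
  apply/vspaceP => w; apply/idP/memv_imgP.
    by case/root_vec_Wroot => x ->; exists x; rewrite ?memvf ?lfunE.
  by case=> x _ ->; apply/root_vec_Wroot; exists x; rewrite lfunE.
rewrite limg_dim_eq; first by rewrite dimvf dim_matrix mulr1.
apply/eqP; rewrite -subv0; apply/subvP => x; rewrite memv_cap memv_ker lfunE /=.
by move=> /andP[_ /eqP h]; rewrite memv0; apply/eqP/root_vec_inj; rewrite h linear0.
Qed.

(** Over the Laurent ring, the image of a kernel basis vector under sigma_p has two expansions: by
    the rows of sigma_p ([wE]) and by the matrix of [artin p] ([w_sum]). Applying [theta] to their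
    equality gives the claim. *)
Lemma ker_comb_rho p x e :
  ker_comb (rhoK dex_inj dex_last dex_wt dex_surj theta (artin p) *m x) e =
  sigma_coef (R_spec q s) p (ker_comb x) e.
Proof.
pose w j := rhoW l (artin p) (ker_basis dex_wt j).
have wE j : cf (val (w j)) e = sigma_coef RL_dual p (ker_coef dex j) e.
  rewrite rhoW_artin cf_sigmaJK; apply: eq_bigr => a _; congr (_ * _).
  exact: cf_ker_vec.
have w_sum j : cf (val (w j)) e =
    \sum_i coordW dex (w j) i 0 * ker_coef dex i e.
  rewrite [w j in LHS](coordWK dex_inj dex_last dex_wt dex_surj).
  rewrite raddf_sum cf_sum; apply: eq_bigr => i _.
  by rewrite -(cf_ker_vec dex_wt) -cfZ; congr (cf _ _).
transitivity (\sum_j x j 0 * theta (cf (val (w j)) e)).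
  under [RHS]eq_bigr do rewrite w_sum rmorph_sum mulr_sumr.
  rewrite exchange_big; apply: eq_bigr => i _; rewrite mxE mulr_suml.
  by apply: eq_bigr => j _; rewrite !mxE (rmorphM theta) [RHS]mulrCA [RHS]mulrA.
under eq_bigr do rewrite wE (spec_sigma_coef theta_q theta_s (s_root_q R r_gt1)
  (q_root_brace R r_gt1) _ _ l_lt_r (ker_coef_wt dex_wt _)) mulr_sumr.
rewrite exchange_big; apply: eq_bigr => a _ /=; rewrite mulr_sumr.
by apply: eq_bigr => i _; rewrite mulrCA.
Qed.

Lemma root_vec_rho p x :
  root_vec (rhoK dex_inj dex_last dex_wt dex_surj theta (artin p) *m x) =
  sigma_root R r p (root_vec x).
Proof.
rewrite (sigma_root_vec l_lt_r p (ker_comb_wt x)); apply/ffunP => t.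
by rewrite !ffunE ker_comb_rho.
Qed.

End Assembly.

(** Both representations are compared with the same matrices [rho]: [psi] identifies column vectors
    with the kernel at the root of unity, [phi] identifies the base change with column vectors, and
    [psi \o phi] is the isomorphism. Equivariance of [psi] is tested on the Artin generators, which
    generate the group. *)
Theorem theorem2p18 (R : realType) (n r l : nat)
    (hn : (2 <= n)%N) (hr : (2 <= r)%N) (hl : (l < r)%N) :
  \dim (Wroot R r n l) = 'C(n + l - 2, l) /\
  exists (rho : {multiplicative braid n -> GL R[i] 'C(n + l - 2, l)})
         (psi : {linear 'cV[R[i]]_('C(n + l - 2, l)) -> Vroot R r n})
         (rhoJK : braid n -> {linear WJK n l -> WJK n l})
         (phi : {linear base_change (spec_root R r) (WJK n l) ->
                        'cV[R[i]]_('C(n + l - 2, l))}),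
    [/\ injective psi
          /\ (forall w, w \in Wroot R r n l <-> exists x, w = psi x),
        forall p x, psi (rho (artin p) *m x) = sigma_root R r p (psi x),
        is_rep rhoJK,
        forall p w, val (rhoJK (artin p) w) = sigmaJK p (val w)
      & bijective phi
          /\ forall g x, phi (bc_map (rhoJK g) x)
                         = rho g *m phi x].
Proof.
case: n hn => [|[|m]] // _.
have [dex [dex_inj dex_last dex_wt dex_surj]] := kernel_index m l.
split; first exact: (dim_Wroot R hl dex_inj dex_last dex_wt dex_surj).
pose theta := spec_root R r.
exists (Multiplicative.clone _ _ (rhoK dex_inj dex_last dex_wt dex_surj theta) _).
exists (GRing.Linear.clone _ _ _ _ (root_vec r dex) _), (@rhoW m.+2 l).
exists (GRing.Linear.clone _ _ _ _ (bc_coord dex (theta := theta)) _).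
split.
- split; first exact: (root_vec_inj hl dex_inj dex_last dex_wt).
  exact: (root_vec_Wroot hl dex_inj dex_last dex_wt dex_surj).
- exact: (root_vec_rho hr hl dex_inj dex_last dex_wt dex_surj).
- exact: rhoW_rep.
- exact: rhoW_artin.
split; first exact: (bc_coord_bij dex_inj dex_last dex_wt dex_surj).
exact: bc_coord_rho.
Qed.
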